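(* Let $\Gamma=\{\gamma(\tau):0\le\tau\le\mathcal T\}$ be the limit cycle of $\dot x=b(x)$ in $\mathbb{R}^d$, with moving frame and the associated $\mathcal T$-periodic $(d-1)\times(d-1)$ matrix functions $\widetilde M(\tau)$, $\widetilde A(\tau)$ as defined in the context. The periodic Riccati differential equation $$\dot G(\tau)=-\widetilde M(\tau)^{\mathsf T}G(\tau)-G(\tau)\widetilde M(\tau)-G(\tau)\widetilde A(\tau)G(\tau)$$ admits a unique $\mathcal T$-periodic positive definite solution if and only if the following two conditions hold: (i) the limit cycle $\Gamma$ is asymptotically stable; (ii) at some $\tau'\in[0,\mathcal T)$, the pair of constant matrices $(\bar\Phi_{\widetilde M}(\tau'),\,W(\tau'+\mathcal T,\tau'))$ is controllable, where $\bar\Phi_{\widetilde M}$ is the monodromy matrix of $\widetilde M$ and $$W(\tau,\tau_0)=\int_{\tau_0}^{\tau}\Phi_{\widetilde M}(\tau,s)\,\widetilde A(s)\,\Phi_{\widetilde M}(\tau,s)^{\mathsf T}\,ds .$$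
   Context: Setting. $b:\mathbb{R}^d\to\mathbb{R}^d$ is a smooth vector field; $\sigma$ is a $d\times d$ matrix-valued function on $\mathbb{R}^d$; $a(x)=\sigma(x)\sigma(x)^{\mathsf T}$ (symmetric positive semidefinite). $\gamma$ is a periodic solution of $\dot\gamma(\tau)=b(\gamma(\tau))$ with least period $\mathcal T>0$, $\dot\gamma$ never vanishes, and $\Gamma=\{\gamma(\tau):\tau\in[0,\mathcal T]\}$. Moving frame. $e_0,\dots,e_{d-1}$ are differentiable $\mathcal T$-periodic maps into $\mathbb{R}^d$ such that for every $\tau$ the vectors $e_0(\tau),\dots,e_{d-1}(\tau)$ form a basis of $\mathbb{R}^d$ (not necessarily orthogonal), and $e_0(\tau)=\lambda(\tau)\dot\gamma(\tau)$ is a unit tangent vector field, with $\lambda$ a nonzero $\mathcal T$-periodic scalar function. $e^0(\tau),\dots,e^{d-1}(\tau)$ is the reciprocal basis: $\langle e^i(\tau),e_j(\tau)\rangle=\delta^i_j$. Matrices. For $1\le i,j\le d-1$, define $(d-1)\times(d-1)$ matrices by $\widetilde\Omega(\tau)_{ij}=\langle e^i(\tau),\dot e_j(\tau)\rangle$, $\widetilde J(\tau)_{ij}=\langle e^i(\tau),\partial_x b(\gamma(\tau))\,e_j(\tau)\rangle$ (where $\partial_x b$ is the Jacobian matrix of $b$), $\widetilde A(\tau)_{ij}=\langle e^i(\tau),a(\gamma(\tau))\,e^j(\tau)\rangle$, and $\widetilde M(\tau)=\widetilde J(\tau)-\widetilde\Omega(\tau)$; $\widetilde M(\cdot)$ is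 understood to be continuous. Floquet notions. For a continuous $\mathcal T$-periodic $n\times n$ matrix function $M(\cdot)$, the state transition matrix $\Phi_M(\tau,\tau_0)$ solves $\partial_\tau\Phi_M(\tau,\tau_0)=M(\tau)\Phi_M(\tau,\tau_0)$, $\Phi_M(\tau_0,\tau_0)=I$; the monodromy matrix is $\bar\Phi_M(\tau)=\Phi_M(\tau+\mathcal T,\tau)$; the characteristic multipliers of $M(\cdot)$ are the eigenvalues of $\bar\Phi_M(\tau)$ (independent of $\tau$). The matrix function $\partial_xb(\gamma(\cdot))$ always has $1$ as a characteristic multiplier. Asymptotic stability of $\Gamma$. $\Gamma$ is called asymptotically stable if, except for the trivial characteristic multiplier $1$, the other $d-1$ characteristic multipliers of $\partial_x b(\gamma(\cdot))$ lie in the open unit disk of $\mathbb{C}$. Controllability. A pair $(M(\cdot),N(\cdot))$ of real $\mathcal T$-periodic $n\times n$ and $n\times m$ matrix functions is controllable if there is no left eigenvector $u$ of $\bar\Phi_M(0)$ with $u\,\Phi_M(\tau,0)^{-1}N(\tau)=0$ for all $\tau\in[0,\mathcal T]$. For a pair of constant matrices $(M,N)$ this is equivalent to the usual condition: there is no left eigenvector $u$ of $M$ with $uN=0$. ''Positive definite solution'' means a symmetric matrix solution that is positive definite for every $\tau$.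
   Formalization: The matrix function Ã(τ) is additionally assumed continuous (implied by continuity of σ); with no regularity on σ the equivalence fails, e.g. when Ã is altered at a single point of the orbit. *)

(* Defs.v *)
From mathcomp Require Import all_boot all_order all_algebra.
From mathcomp Require Import all_classical all_reals all_analysis.
From mathcomp Require Import complex.

Set Implicit Arguments.
Unset Strict Implicit.
Unset Printing Implicit Defensive.

Import Order.TTheory GRing.Theory Num.Theory.
Import numFieldNormedType.Exports.

Local Open Scope classical_set_scope.
Local Open Scope ring_scope.

(* The Euclidean structure of R^d.  The library norm `|x| on matrices is the
   sup norm, so it cannot be used for unit vectors. *)
Definition dot (R : realType) (d : nat) (u v : 'cV[R]_d) : R :=
  \sum_(i < d) u i 0 * v i 0.

Definition enorm (R : realType) (d : nat) (u : 'cV[R]_d) : R :=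
  Num.sqrt (dot u u).

(* For finite-dimensional V this is the usual class C^k. *)
Fixpoint of_class_C (R : realType) (V W : normedModType R) (k : nat)
    (f : V -> W) : Prop :=
  match k with
  | 0%N => continuous f
  | k'.+1 => (forall x, differentiable f x) /\
             (forall v, of_class_C k' (fun x => 'D_v f x))
  end.

Definition smooth (R : realType) (V W : normedModType R) (f : V -> W) : Prop :=
  forall k, of_class_C k f.

(* The library's [jacobian] acts on row vectors; this is the usual
   Jacobian matrix (d b_i / d x_j)_(i, j) for column vectors. *)
Definition jacobian_mx (R : realType) (d : nat) (b : 'cV[R]_d -> 'cV[R]_d)
    (x : 'cV[R]_d) : 'M[R]_d :=
  \matrix_(i, j) ('D_(delta_mx j 0) b x) i 0.

Record limit_cycle (R : realType) (d : nat) (b : 'cV[R]_d -> 'cV[R]_d)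
    (gamma : R -> 'cV[R]_d) (T : R) : Prop := LimitCycle {
  lc_sol : forall t : R, is_derive t (1 : R) gamma (b (gamma t));
  lc_period_gt0 : 0 < T;
  lc_periodic : periodic gamma T;
  lc_least : forall T' : R, 0 < T' -> periodic gamma T' -> T <= T';
  lc_regular : forall t, derive1 gamma t != 0 }.

(* e is the frame, with e_0 = lam * gamma' the unit tangent, and edual is its
   reciprocal basis. *)
Record moving_frame (R : realType) (n : nat) (gamma : R -> 'cV[R]_n.+1) (T : R)
    (e edual : 'I_n.+1 -> R -> 'cV[R]_n.+1) (lam : R -> R) : Prop := MovingFrame {
  mf_derivable : forall i (t : R), derivable (e i) t (1 : R);
  mf_periodic : forall i, periodic (e i) T;
  mf_basis : forall t, basis_of fullv [seq e i t | i <- enum 'I_n.+1];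
  mf_lam_neq0 : forall t, lam t != 0;
  mf_lam_periodic : periodic lam T;
  mf_tangent : forall t, e ord0 t = lam t *: derive1 gamma t;
  mf_unit : forall t, enorm (e ord0 t) = 1;
  mf_reciprocal : forall t i j, dot (edual i t) (e j t) = (i == j)%:R }.

(* The indices 1, ..., d - 1 are [lift ord0 i] for i < n, where d = n + 1. *)
Section frame_matrices.
Context (R : realType) (n : nat).
Implicit Types (b : 'cV[R]_n.+1 -> 'cV[R]_n.+1) (gamma : R -> 'cV[R]_n.+1).
Implicit Types (sigma : 'cV[R]_n.+1 -> 'M[R]_n.+1).
Implicit Types (e edual : 'I_n.+1 -> R -> 'cV[R]_n.+1) (t : R).

Definition Omega_t e edual t : 'M[R]_n :=
  \matrix_(i, j) dot (edual (lift ord0 i) t) (derive1 (e (lift ord0 j)) t).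

Definition J_t b gamma e edual t : 'M[R]_n :=
  \matrix_(i, j)
    dot (edual (lift ord0 i) t) (jacobian_mx b (gamma t) *m e (lift ord0 j) t).

Definition diffusion sigma (x : 'cV[R]_n.+1) : 'M[R]_n.+1 :=
  sigma x *m (sigma x)^T.

Definition A_t sigma gamma edual t : 'M[R]_n :=
  \matrix_(i, j)
    dot (edual (lift ord0 i) t) (diffusion sigma (gamma t) *m edual (lift ord0 j) t).

Definition M_t b gamma e edual t : 'M[R]_n := J_t b gamma e edual t - Omega_t e edual t.

End frame_matrices.

Section floquet.
Context (R : realType) (n : nat).
Implicit Types (M : R -> 'M[R]_n) (T t s : R).

Definition is_transition M (Phi : R -> R -> 'M[R]_n) : Prop :=
  forall t0, Phi t0 t0 = 1%:M /\
             (forall t : R, is_derive t (1 : R) (Phi ^~ t0) (M t *m Phi t t0)).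

(* The state transition matrix; it exists and is unique for continuous M. *)
Definition transition M : R -> R -> 'M[R]_n :=
  xget (fun _ _ => 0) [set Phi | is_transition M Phi].

Definition monodromy T M t : 'M[R]_n := transition M (t + T) t.

(* z lists the characteristic multipliers, repeated according to algebraic
   multiplicity. *)
Definition multipliers T M (z : seq R[i]) : Prop :=
  char_poly (map_mx (real_complex R) (monodromy T M 0)) =
  \prod_(x <- z) ('X - x%:P).

Definition controllable (m : nat) T M (N : R -> 'M[R]_(n, m)) : Prop :=
  ~ exists (u : 'rV[R[i]]_n) (mu : R[i]),
      [/\ u != 0,
          u *m map_mx (real_complex R) (monodromy T M 0) = mu *: u &
          forall t, 0 <= t <= T ->
            u *m map_mx (real_complex R) (invmx (transition M t 0) *m N t) = 0].

(* Entrywise Lebesgue integral, for t0 <= t. *)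
Definition gramian M (A : R -> 'M[R]_n) t t0 : 'M[R]_n :=
  \matrix_(i, j) \int[lebesgue_measure]_(s in `[t0, t])
    (transition M t s *m A s *m (transition M t s)^T) i j.

Definition posdef (G : 'M[R]_n) : Prop :=
  G^T = G /\ (forall v : 'cV[R]_n, v != 0 -> 0 < dot v (G *m v)).

Definition riccati_solution M (A : R -> 'M[R]_n) (G : R -> 'M[R]_n) : Prop :=
  forall t : R, is_derive t (1 : R) G
    (- ((M t)^T *m G t) - G t *m M t - G t *m A t *m G t).

End floquet.

Definition asymptotically_stable (R : realType) (d : nat)
    (b : 'cV[R]_d -> 'cV[R]_d) (gamma : R -> 'cV[R]_d) (T : R) : Prop :=
  exists z : seq R[i],
    multipliers T (fun t => jacobian_mx b (gamma t)) (1 :: z) /\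
    (forall x, x \in z -> `|x| < 1).

(* Main.v *)
(* The substitution P = G^-1 turns the Riccati equation into the periodic Lyapunov
   equation P' = M P + P M^T + A.  Sampling it over one period, its T-periodic
   solutions correspond to the solutions of the Stein equation P = F P F^T + W, with
   F the monodromy matrix and W the Gramian at the sampling time.

   If P is positive definite, every eigenvalue of F has modulus at most 1, and one of
   modulus 1, with eigenvector x + iy, makes P + x x^T + y y^T another solution; so
   uniqueness forces spectral radius < 1, and then F^k -> 0 excludes a nonzero row
   vector annihilated by all the F^k W.  Conversely spectral radius < 1 makes the
   Stein equation uniquely solvable with P semidefinite, and the left kernel of P,
   being F-invariant and annihilated by W, is trivial by controllability.

   In the moving frame the variational equation along the orbit is block triangular,
   with the tangent direction as the first block; so its characteristic multipliers
   are 1 and those of M. *)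

Require Import Defs.
From mathcomp Require Import all_boot all_order all_algebra.
From mathcomp Require Import all_classical all_reals all_analysis.
From mathcomp Require Import complex ring lra.

Set Implicit Arguments.
Unset Strict Implicit.
Unset Printing Implicit Defensive.

Import Order.TTheory GRing.Theory Num.Theory.
Import numFieldNormedType.Exports.

Local Open Scope classical_set_scope.
Local Open Scope ring_scope.

(** * Matrix calculus on the line *)

Section calculus.
Context {R : realType}.

Lemma is_derive_mxP {m n} (X : R -> 'M[R]_(m, n)) (t : R) dX :
  is_derive t (1 : R) X dX <->
  forall i j, is_derive t (1 : R) (fun s => X s i j) (dX i j).
Proof.
split=> [[Xt <-] i j|H].
  have := (derivable_mxP _ _ _).1 Xt i j => /derivableP.
  by rewrite derive_mx// mxE.
have Xt : derivable X t 1 by apply/derivable_mxP => i j; have [] := H i j.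
apply: DeriveDef => //; rewrite derive_mx//; apply/matrixP => i j.
by rewrite mxE; have [] := H i j.
Qed.

Lemma is_derive_mulmx {m n p} (X : R -> 'M[R]_(m, n)) (Y : R -> 'M[R]_(n, p))
    (t : R) dX dY :
  is_derive t (1 : R) X dX -> is_derive t (1 : R) Y dY ->
  is_derive t (1 : R) (fun s => X s *m Y s) (dX *m Y t + X t *m dY).
Proof.
move=> /is_derive_mxP HX /is_derive_mxP HY; apply/is_derive_mxP => i j.
have -> : (fun s => (X s *m Y s) i j) =
    \sum_(k < n) ((fun s => X s i k) * (fun s => Y s k j)).
  by apply/funext => s; rewrite mxE fct_sumE.
apply: (is_derive_eq (is_derive_sum (fun k => is_deriveM (HX i k) (HY k j)))).
rewrite !mxE -big_split; apply: eq_bigr => k _ /=.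
by rewrite addrC /GRing.scale /= (mulrC (Y t k j)).
Qed.

Lemma is_derive_trmx {m n} (X : R -> 'M[R]_(m, n)) (t : R) dX :
  is_derive t (1 : R) X dX -> is_derive t (1 : R) (fun s => (X s)^T) dX^T.
Proof.
move=> /is_derive_mxP HX; apply/is_derive_mxP => i j; rewrite mxE.
by under eq_fun do rewrite mxE.
Qed.

Lemma is_derive_cstT {V : normedModType R} (c : V) (t : R) :
  is_derive t (1 : R) (fun=> c) 0.
Proof. exact: is_derive_cst. Qed.

Lemma is_derive_mulmxl {m n p} (C : 'M[R]_(m, n)) (Y : R -> 'M[R]_(n, p))
    (t : R) dY :
  is_derive t (1 : R) Y dY -> is_derive t (1 : R) (fun s => C *m Y s) (C *m dY).
Proof.
move=> HY; have := is_derive_mulmx (is_derive_cstT C t) HY.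
by rewrite mul0mx add0r.
Qed.

Lemma is_derive_mulmxr {m n p} (Y : R -> 'M[R]_(m, n)) (C : 'M[R]_(n, p))
    (t : R) dY :
  is_derive t (1 : R) Y dY -> is_derive t (1 : R) (fun s => Y s *m C) (dY *m C).
Proof.
move=> HY; have := is_derive_mulmx HY (is_derive_cstT C t).
by rewrite mulmx0 addr0.
Qed.

Lemma is_derive_continuous (V : normedModType R) (f df : R -> V) :
  (forall t, is_derive t (1 : R) f (df t)) -> continuous f.
Proof.
move=> H t; apply: differentiable_continuous.
by apply/derivable1_diffP; have [] := H t.
Qed.

Lemma is_derive_addr (V : normedModType R) (f : R -> V) (c t : R) df :
  is_derive (t + c) (1 : R) f df -> is_derive t (1 : R) (fun s => f (s + c)) df.
Proof.
move=> [Hf <-].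
have E : (fun h : R => h^-1 *: (((fun s => f (s + c)) \o shift t) (h *: 1) - f (t + c)))
   = (fun h : R => h^-1 *: ((f \o shift (t + c)) (h *: 1) - f (t + c))).
  by apply/funext => h /=; rewrite addrA.
by apply: DeriveDef; rewrite /derivable /derive E.
Qed.

Lemma is_derive_oppx (f : R -> R) (t : R) df :
  is_derive (- t) (1 : R) f df -> is_derive t (1 : R) (fun s => f (- s)) (- df).
Proof.
move=> Hf; have := @is_derive1_comp _ f -%R t df (-1) Hf (is_deriveNid _ _).
by rewrite mulrN1.
Qed.

Lemma is_derive_nondecreasing (f df : R -> R) (a b : R) :
  (forall t, is_derive t (1 : R) f (df t)) ->
  a <= b -> (forall t, a <= t <= b -> 0 <= df t) -> f a <= f b.
Proof.
move=> H ab H0; rewrite -subr_ge0.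
have [|c cab ->] := @MVT_segment _ f df a b ab (fun x _ => H x).
  by apply: continuous_subspaceT; exact: is_derive_continuous H.
by rewrite mulr_ge0 ?subr_ge0// H0// -in_itv.
Qed.

Lemma is_derive_mx_cst {m n} (X : R -> 'M[R]_(m, n)) (s t : R) :
  (forall t, is_derive t (1 : R) X 0) -> X s = X t.
Proof.
move=> H; apply/matrixP => i j.
apply: (@is_derive_0_is_cst _ (fun s => X s i j)) => u.
by have /is_derive_mxP/(_ i j) := H u; rewrite mxE.
Qed.

Lemma continuous_mxP {m n} (X : R -> 'M[R]_(m, n)) :
  continuous X <-> forall i j, continuous (fun t => X t i j).
Proof.
split=> [cX i j t|cX t].
  by apply: (@continuous_comp _ _ _ X (fun A : 'M[R]_(m, n) => A i j));
    [exact: cX|exact: coord_continuous].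
apply/cvgrPdist_le => /= e e0; near=> x.
rewrite /Num.Def.normr/= mx_normrE (bigmax_le _ (ltW e0))//= => i _.
rewrite !mxE/=; move: i; near: x; apply: filter_forall => /= i.
exact: ((cvgrPdist_le _ _).1 (cX i.1 i.2 t)).
Unshelve. all: by end_near. Qed.

Lemma cvg_bigsum {I S : Type} (F : set_system S) {FF : Filter F} (r : seq I)
    (f : I -> S -> R) (l : I -> R) :
  (forall i, f i x @[x --> F] --> l i) ->
  \sum_(i <- r) f i x @[x --> F] --> \sum_(i <- r) l i.
Proof.
move=> H; elim: r => [|i r IH].
  by rewrite big_nil; under eq_fun do rewrite big_nil; exact: cvg_cst.
rewrite big_cons; under eq_fun do rewrite big_cons.
by apply: cvgD.
Qed.

Lemma continuous_mulmx {m n p} (X : R -> 'M[R]_(m, n)) (Y : R -> 'M[R]_(n, p)) :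
  continuous X -> continuous Y -> continuous (fun t => X t *m Y t).
Proof.
move=> /continuous_mxP cX /continuous_mxP cY; apply/continuous_mxP => i j.
have -> : (fun s => (X s *m Y s) i j) =
    (fun s => \sum_(k < n) (X s i k) * (Y s k j)).
  by apply/funext => s; rewrite mxE.
move=> t; apply: cvg_bigsum => k.
by apply: cvgM; [exact: cX|exact: cY].
Qed.

Lemma continuous_trmx {m n} (X : R -> 'M[R]_(m, n)) :
  continuous X -> continuous (fun t => (X t)^T).
Proof.
move=> /continuous_mxP cX; apply/continuous_mxP => i j.
by under eq_fun do rewrite mxE; exact: cX.
Qed.

Lemma continuous_oppmx {m n} (X : R -> 'M[R]_(m, n)) :
  continuous X -> continuous (fun t => - X t).
Proof. by move=> cX t; apply: cvgN; exact: cX. Qed.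

(** Freezing the argument at 0 and subtracting [f 0] makes the integrand vanish on the negative
    half-line. It is then integrable on every ray []-oo, u]], and the fundamental theorem from -oo
    applies at every t. *)
Let half_antiderivative (f : R -> R) : continuous f ->
  exists F : R -> R, forall t : R, is_derive t (1 : R) F (f (Num.max t 0) - f 0).
Proof.
move=> cf; pose g (x : R) : R := f (Num.max x 0) - f 0.
have cg : continuous g.
  move=> x; apply: cvgB; last exact: cvg_cst.
  apply: continuous_comp; last exact: cf.
  by apply: continuous_max; [exact: cvg_id|exact: cvg_cst].
pose F x := (\int[lebesgue_measure]_(t in [set` `]-oo, x]]) (g t)).
exists F => t.
have ig (u : R) : lebesgue_measure.-integrable [set` `]-oo, u]] (EFin \o g).
  suff: lebesgue_measure.-integrable [set` `]-oo, u]] ((EFin \o g) \_ `[0, u]).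
    apply: eq_integrable => //= x; rewrite inE/= in_itv/= /patch => xu.
    case: ifPn => // /negP x0; rewrite /= /g max_r ?subrr//.
    by rewrite leNgt; apply/negP => {}/ltW x0'; apply: x0; rewrite inE/= in_itv/= x0'.
  apply/integrable_restrict => //; rewrite setIidr; last first.
    by move=> x /=; rewrite !in_itv/= => /andP[].
  apply: continuous_compact_integrable; first exact: segment_compact.
  exact: continuous_subspaceT.
have [|||dF F'] := @continuous_FTC1 R g -oo%O t (t + 1) _ (ig _).
- by rewrite ltrDl.
- by rewrite ltNyr.
- exact: cg.
by split; [exact: dF|rewrite -derive1E; exact: F'].
Qed.

Lemma antiderivative (f : R -> R) : continuous f ->
  exists F : R -> R, forall t : R, is_derive t (1 : R) F (f t).
Proof.
move=> cf; have [F1 HF1] := half_antiderivative cf.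
have [|F2 HF2] := @half_antiderivative (fun x => f (- x)).
  move=> x; apply: continuous_comp; [exact: opp_continuous|exact: cf].
(* At each t one of the two half-line terms contributes f t - f 0 and the other 0; the linear term
   restores f 0. *)
exists (F1 - (fun x => F2 (- x)) + f 0 \*: (id : R -> R)) => t.
have H2 := is_derive_oppx (HF2 (- t)).
apply: (is_derive_eq (is_deriveD (is_deriveB (HF1 t) H2)
  (is_deriveZ (f 0) (is_derive_id t 1)))).
have -> : f 0 *: 1 = f 0 :> R by rewrite /GRing.scale /= mulr1.
rewrite oppr0; case/orP: (le_total 0 t) => t0.
  rewrite (max_l t0) (_ : Num.max (- t) 0 = 0) ?oppr0; last first.
    by apply/max_r; rewrite oppr_le0.
  ring.
rewrite (max_r t0) (_ : Num.max (- t) 0 = - t) ?opprK; last first.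
  by apply/max_l; rewrite oppr_ge0.
ring.
Qed.

Lemma mx_antiderivative {m n} (X : R -> 'M[R]_(m, n)) : continuous X ->
  exists Y : R -> 'M[R]_(m, n), forall t, is_derive t (1 : R) Y (X t).
Proof.
move=> /continuous_mxP cX.
pose F i j := sval (cid (antiderivative (cX i j))).
exists (fun t => \matrix_(i, j) F i j t) => t; apply/is_derive_mxP => i j.
under eq_fun do rewrite mxE.
exact: (svalP (cid (antiderivative (cX i j)))).
Qed.

End calculus.

(** * Linear differential equations *)

Section linear_ode.
Context {R : realType}.

Lemma mx_norm_leP {m n} (X : 'M[R]_(m, n)) (c : R) : 0 <= c ->
  reflect (forall i j, `|X i j| <= c) (`|X| <= c).
Proof.
move=> c0; rewrite [`|X|]/Num.Def.normr/= mx_normrE.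
apply: (iffP idP) => [H i j|H].
  apply: le_trans H; exact: (le_bigmax _ (fun ij => `|X ij.1 ij.2|) (i, j)).
by apply: bigmax_le => // -[i j] _ /=.
Qed.

Lemma mx_norm_entry {m n} (X : 'M[R]_(m, n)) i j : `|X i j| <= `|X|.
Proof. by move: i j; apply/mx_norm_leP. Qed.

Lemma mx_norm_mul {m n p} (X : 'M[R]_(m, n)) (Y : 'M[R]_(n, p)) :
  `|X *m Y| <= n%:R * `|X| * `|Y|.
Proof.
apply/mx_norm_leP => [|i j]; first by rewrite !mulr_ge0.
rewrite mxE (le_trans (ler_norm_sum _ _ _))//.
rewrite -mulrA mulr_natl -[X in _ *+ X](card_ord n) -sumr_const.
by apply: ler_sum => k _; rewrite normrM ler_pM// mx_norm_entry.
Qed.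

(** The difference between the exponential bound and f has nonnegative derivative and starts at K /
    c >= 0. *)
Let gronwall_right (f df : R -> R) (t0 L K c : R) :
    (forall t, is_derive t (1 : R) f (df t)) -> f t0 = 0 -> 0 < c -> 0 <= K ->
    (forall t, t0 <= t <= t0 + L -> df t <= K * expR (c * (t - t0))) ->
  forall t, t0 <= t <= t0 + L -> f t <= K / c * expR (c * (t - t0)).
Proof.
move=> Hf f0 c0 K0 Hd t /andP[t0t tL].
pose u (s : R) := c * (s - t0).
have Hu s : is_derive s (1 : R) u c.
  have -> : u = c \*: ((id : R -> R) - (fun=> t0)) by [].
  apply: (is_derive_eq (is_deriveZ c (is_deriveB (is_derive_id s 1)
    (is_derive_cstT t0 s)))).
  by rewrite subr0 /GRing.scale /= mulr1.
have Hg s : is_derive s (1 : R) ((K / c) \*: (expR \o u) - f)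
    (K * expR (c * (s - t0)) - df s).
  have He := @is_derive1_comp _ expR u s _ _ (is_derive_expR _) (Hu s).
  apply: (is_derive_eq (is_deriveB (is_deriveZ (K / c) He) (Hf s))).
  rewrite /GRing.scale /= /u; congr (_ - _); field.
  by rewrite gt_eqF.
have Kc : 0 <= K / c by rewrite divr_ge0// ltW.
have := is_derive_nondecreasing Hg t0t.
rewrite !fctE /= f0 subr0 -subr_ge0 => H.
rewrite -subr_ge0; apply: le_trans (H _) _ => [s /andP[s1 s2]|].
  by rewrite subr_ge0 Hd// s1/= (le_trans s2).
by rewrite lerBlDr lerDl /GRing.scale /= mulr_ge0// expR_ge0.
Qed.

Let gronwall_abs_right (f df : R -> R) (t0 L K c : R) :
    (forall t, is_derive t (1 : R) f (df t)) -> f t0 = 0 -> 0 < c -> 0 <= K ->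
    (forall t, t0 <= t <= t0 + L -> `|df t| <= K * expR (c * (t - t0))) ->
  forall t, t0 <= t <= t0 + L -> `|f t| <= K / c * expR (c * (t - t0)).
Proof.
move=> Hf f0 c0 K0 Hd t tL; rewrite ler_norml lerNl; apply/andP; split.
  have Hg s : is_derive s (1 : R) (- f) (- df s) by exact: is_deriveN.
  apply: (gronwall_right Hg) tL; rewrite ?fctE ?f0 ?oppr0// => s sL.
  by rewrite (le_trans (ler_norm _))// normrN Hd.
apply: (gronwall_right Hf) tL => // s sL.
by rewrite (le_trans (ler_norm _))// Hd.
Qed.

(** Works entry by entry, since the norm is the maximum of the entries; times before t0 are reduced
    to later ones by reversing time. The gain is the factor 1 / c, which makes Picard steps
    contract. *)
Lemma gronwall_mx {m n} (X dX : R -> 'M[R]_(m, n)) (t0 L K c : R) :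
    (forall t, is_derive t (1 : R) X (dX t)) -> X t0 = 0 -> 0 < c -> 0 <= K ->
    (forall t, `|t - t0| <= L -> `|dX t| <= K * expR (c * `|t - t0|)) ->
  forall t, `|t - t0| <= L -> `|X t| <= K / c * expR (c * `|t - t0|).
Proof.
move=> HX X0 c0 K0 Hd t tL.
apply/mx_norm_leP => [|i j].
  by rewrite mulr_ge0 ?expR_ge0// divr_ge0// ltW.
have Hf s : is_derive s (1 : R) (fun s => X s i j) (dX s i j).
  exact: ((is_derive_mxP _ _ _).1 (HX s)).
case/orP: (le_total t0 t) => tt0.
  move: tL; rewrite ger0_norm ?subr_ge0// => tL.
  apply: (@gronwall_abs_right _ _ t0 L K c Hf) => //; first by rewrite X0 mxE.
    move=> s /andP[s1 s2]; rewrite (le_trans (mx_norm_entry _ _ _))//.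
    have := Hd s; rewrite ger0_norm ?subr_ge0//; apply.
    by rewrite lerBlDl.
  by rewrite tt0 -lerBlDl.
move: tL; rewrite distrC ger0_norm ?subr_ge0// => tL.
have Hg s : is_derive s (1 : R) (fun s => X (- s) i j) (- dX (- s) i j).
  exact: (is_derive_oppx (Hf (- s))).
have := @gronwall_abs_right _ _ (- t0) L K c Hg.
rewrite opprK X0 mxE => /(_ erefl c0 K0 _ (- t)).
rewrite !opprK (addrC (- t)); apply.
  move=> s /andP[s1 s2]; rewrite normrN (le_trans (mx_norm_entry _ _ _))//.
  have := Hd (- s); rewrite distrC opprK (addrC t0) ger0_norm; last first.
    by rewrite -[t0]opprK subr_ge0.
  by apply; rewrite -[t0]opprK lerBlDl.
by rewrite lerN2 tt0/= -lerBlDl opprK addrC.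
Qed.

Lemma continuous_mx_bound {m n} (X : R -> 'M[R]_(m, n)) (t0 L : R) :
  continuous X -> exists2 C : R, 0 <= C & forall t, `|t - t0| <= L -> `|X t| <= C.
Proof.
move=> cX; have [L0|L0] := leP 0 L; last first.
  by exists 0 => // t /le_lt_trans/(_ L0); rewrite ltNge normr_ge0.
have [||c _ Hc] := @EVT_max R (fun t => `|X t|) (t0 - L) (t0 + L).
- by rewrite lerBlDr -addrA lerDl addr_ge0.
- apply: continuous_subspaceT => t.
  by apply: (@continuous_comp _ _ _ X (fun A => `|A|));
    [exact: cX|exact: norm_continuous].
exists `|X c| => // t tL; apply: Hc; rewrite in_itv/=.
by move: tL; rewrite ler_norml => /andP[]; rewrite lerBlDl lerBrDl => -> ->.
Qed.

(** * Existence for X' = M X by Picard iteration *)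

Section existence.
Context {n : nat} (M : R -> 'M[R]_n) (t0 : R).
Hypothesis cM : continuous M.

(** Choosing a primitive keeps integrals out of the Picard iteration; for continuous Y, [primP]
    excludes the default value. *)
Let prim (Y : R -> 'M[R]_n) : R -> 'M[R]_n :=
  xget (fun=> 0) [set Z | Z t0 = 0 /\ forall t, is_derive t (1 : R) Z (Y t)].

Let primP (Y : R -> 'M[R]_n) : continuous Y ->
  prim Y t0 = 0 /\ forall t, is_derive t (1 : R) (prim Y) (Y t).
Proof.
move=> cY; rewrite /prim; case: xgetP => [Z _ //|Hn].
have [Z HZ] := mx_antiderivative cY.
exfalso; apply: (Hn (Z - (fun=> Z t0))); split=> [|t].
  by rewrite fctE subrr.
apply: (is_derive_eq (is_deriveB (HZ t) (is_derive_cstT (Z t0) t))).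
by rewrite subr0.
Qed.

(** Terms of the Peano-Baker series; their partial sums [S] are the Picard iterates. *)
Let w k := iter k (fun X => prim (fun t => M t *m X t)) (fun=> 1%:M).

Let w_cont k : continuous (w k).
Proof.
elim: k => [|k IH]; first by move=> t; exact: cvg_cst.
have [_ H] := primP (continuous_mulmx cM IH).
exact: is_derive_continuous H.
Qed.

Let wP k : w k.+1 t0 = 0 /\
  forall t, is_derive t (1 : R) (w k.+1) (M t *m w k t).
Proof. exact: (primP (continuous_mulmx cM (@w_cont k))). Qed.

Let S N t := \sum_(k < N) w k t.

Let S_cont N : continuous (S N).
Proof.
elim: N => [|N IH].
  rewrite /S; under eq_fun do rewrite big_ord0; move=> t; exact: cvg_cst.
rewrite /S; under eq_fun do rewrite big_ord_recr /=.
by move=> t; apply: cvgD; [exact: IH|exact: w_cont].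
Qed.

Let S_derive N t : is_derive t (1 : R) (S N.+1) (M t *m S N t).
Proof.
elim: N => [|N IH].
  rewrite /S big_ord0 mulmx0; under eq_fun do rewrite big_ord1.
  exact: is_derive_cstT.
have -> : S N.+2 = S N.+1 + w N.+1.
  by apply/funext => s; rewrite /S big_ord_recr.
rewrite [X in M t *m X](_ : _ = S N t + w N t); last by rewrite /S big_ord_recr.
by rewrite mulmxDr; apply: is_deriveD => //; exact: (wP N).2.
Qed.

Let S_init N : S N.+1 t0 = 1%:M.
Proof.
rewrite /S big_ord_recl big1 ?addr0// => i _.
exact: (wP i).1.
Qed.

(* The weight exp (c |t - t0|) makes each Picard step contract by 1/2 on the whole
   window |t - t0| <= L. *)
Let w_bound (L : R) : exists c : R, [/\ 0 < c,
  forall t, `|t - t0| <= L -> n%:R * `|M t| <= c / 2 &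
  forall k t, `|t - t0| <= L -> `|w k t| <= 2^-1 ^+ k * expR (c * `|t - t0|)].
Proof.
have [C C0 HC] := continuous_mx_bound t0 L cM.
(* The factor n is the one in [mx_norm_mul]; the added 1 keeps c positive in all cases. *)
pose c := 2 * (n%:R * C + 1).
have c0 : 0 < c by rewrite mulr_gt0// ltr_wpDl// mulr_ge0.
have Mc t : `|t - t0| <= L -> n%:R * `|M t| <= c / 2.
  move=> tL; rewrite /c mulrAC divff// mul1r.
  by rewrite (@le_trans _ _ (n%:R * C)) ?lerDl// ler_wpM2l ?HC.
exists c; split => //; elim=> [|k IH] t tL.
  rewrite expr0 mul1r; apply/mx_norm_leP => [|i j]; first exact: expR_ge0.
  rewrite mxE (@le_trans _ _ 1)//; first by case: eqVneq; rewrite ?normr1 ?normr0.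
  by rewrite -expR0 ler_expR mulr_ge0// ltW.
have [W0 Wd] := wP k.
rewrite exprS.
rewrite (_ : 2^-1 * 2^-1 ^+ k = (c / 2 * 2^-1 ^+ k) / c); last first.
  by field; rewrite gt_eqF.
have K0 : 0 <= c / 2 * 2^-1 ^+ k by rewrite mulr_ge0 ?exprn_ge0// divr_ge0// ltW.
apply: (gronwall_mx Wd W0 c0 K0 _ tL) => s sL.
rewrite (le_trans (mx_norm_mul _ _))// -[leRHS]mulrA.
by rewrite ler_pM ?mulr_ge0 ?Mc ?IH.
Qed.

Let S_cauchy (L : R) : exists c : R, [/\ 0 < c,
  forall t, `|t - t0| <= L -> n%:R * `|M t| <= c / 2 &
  forall N m t, `|t - t0| <= L ->
    `|S (N + m)%N t - S N t| <= 2 * 2^-1 ^+ N * expR (c * `|t - t0|)].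
Proof.
have [c [c0 Mc wc]] := w_bound L; exists c; split => // N m t tL.
(* The exact geometric tail is proved instead, so that the induction on m closes. *)
suff : `|S (N + m)%N t - S N t| <=
    (2 * 2^-1 ^+ N - 2 * 2^-1 ^+ (N + m)) * expR (c * `|t - t0|).
  move=> /le_trans; apply; rewrite ler_wpM2r ?expR_ge0// gerBl.
  by rewrite mulr_ge0// exprn_ge0.
elim: m => [|m IH]; first by rewrite addn0 !subrr normr0 mul0r.
rewrite addnS [S (N + m).+1 t](_ : _ = S (N + m)%N t + w (N + m) t); last first.
  by rewrite /S big_ord_recr.
rewrite addrAC (le_trans (ler_normD _ _))//.
rewrite (le_trans (lerD IH (wc _ _ tL)))// -mulrDl ler_wpM2r ?expR_ge0//.
by rewrite exprS; lra.
Qed.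

Let S_cvg t i j : cvg ((fun N => S N t i j) @ \oo).
Proof.
have [c [c0 _ wc]] := w_bound `|t - t0|.
have -> : (fun N => S N t i j) = series (fun k => w k t i j).
  by apply/funext => N; rewrite /series /S /= summxE big_mkord.
apply: normed_cvg.
apply: (@series_le_cvg _ _ (geometric (expR (c * `|t - t0|)) 2^-1)) => [k|k|k|].
- exact: normr_ge0.
- by rewrite /geometric /= mulr_ge0 ?expR_ge0 ?exprn_ge0.
- rewrite /geometric /= mulrC; exact: le_trans (mx_norm_entry _ _ _) (wc k t _).
- by apply: is_cvg_geometric_series; rewrite ger0_norm// invf_lt1// ltr1n.
Qed.

Let X t : 'M[R]_n := \matrix_(i, j) lim ((fun N => S N t i j) @ \oo).

(** Letting m tend to infinity in [S_cauchy]: the convergence is uniform on the window, with the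
    same c. *)
Let X_S (L : R) : exists c : R, [/\ 0 < c,
  forall t, `|t - t0| <= L -> n%:R * `|M t| <= c / 2 &
  forall N t, `|t - t0| <= L ->
    `|X t - S N t| <= 2 * 2^-1 ^+ N * expR (c * `|t - t0|)].
Proof.
have [c [c0 Mc Sc]] := S_cauchy L; exists c; split => // N t tL.
apply/mx_norm_leP => [|i j]; first by rewrite !mulr_ge0 ?exprn_ge0 ?expR_ge0.
apply/ler_addgt0Pl => e e0.
have /cvgrPdist_le/(_ e e0)[N0 _ HN0] := @S_cvg t i j.
have := HN0 (N + N0)%N (leq_addl _ _) => /= HN.
rewrite !mxE -(subrKA (S (N + N0) t i j)) (le_trans (ler_normD _ _))// lerD//.
have := Sc N N0 t tL; apply: le_trans.
by have := mx_norm_entry (S (N + N0)%N t - S N t) i j; rewrite !mxE.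
Qed.

Let half_small (E e : R) : 0 < e -> exists N, 2^-1 ^+ N * E <= e.
Proof.
move=> e0.
have H : (fun N => 2^-1 ^+ N * E) @ \oo --> (0 * E).
  apply: cvgMl; apply: cvg_expr.
  by rewrite ger0_norm// invf_lt1// ltr1n.
rewrite mul0r in H; move/cvgrPdist_le : H => /(_ e e0)[N _ HN].
exists N; have := HN N (leqnn _); rewrite /= sub0r normrN.
exact: le_trans (ler_norm _).
Qed.

(** A three-epsilon argument: the window of radius |t - t0| + 1 contains a neighbourhood of t, and
    the convergence is uniform on it. *)
Let X_cont : continuous X.
Proof.
move=> t; apply/cvgrPdist_le => e e0.
have [c [c0 _ XS]] := X_S (`|t - t0| + 1).
pose E := expR (c * (`|t - t0| + 1)).
have [N HN] := half_small (2 * E) (divr_gt0 e0 (ltr0Sn R 2)).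
have XE s : `|s - t0| <= `|t - t0| + 1 -> `|X s - S N s| <= e / 3.
  move=> sL; rewrite (le_trans (XS N s sL))// (le_trans _ HN)//.
  rewrite -mulrA mulrCA ler_wpM2l ?exprn_ge0// ler_wpM2l// ler_expR.
  by rewrite ler_wpM2l// ltW.
have /cvgrPdist_le/(_ _ (divr_gt0 e0 (ltr0Sn R 2))) cS := @S_cont N t.
near=> s.
have st1 : `|s - t0| <= `|t - t0| + 1.
  rewrite -(subrKA t) addrC (le_trans (ler_normD _ _))// lerD2l distrC.
  near: s; exact: (cvgrPdist_le _ _).1 (@cvg_id _ _) _ ltr01.
have -> : X t - X s = (X t - S N t) + (S N t - S N s) - (X s - S N s).
  by rewrite subrKA opprB subrKA.
rewrite (le_trans (ler_normB _ _))// (_ : e = e / 3 + e / 3 + e / 3); last by lra.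
rewrite lerD ?XE// (le_trans (ler_normD _ _))// lerD ?XE ?lerDl//.
by near: s.
Unshelve. all: by end_near. Qed.

(** It suffices that X equals 1 + Z, where Z is the primitive of M X vanishing at t0. Both are close
    to S (N + 1): its difference from 1 + Z has derivative M (S N - X), which is small by [X_S] and
    is integrated by [gronwall_mx]. *)
Lemma linear_ode_exists : exists X : R -> 'M[R]_n,
  X t0 = 1%:M /\ forall t : R, is_derive t (1 : R) X (M t *m X t).
Proof.
have [Z0 Zd] := primP (continuous_mulmx cM X_cont).
set Z := prim _ in Z0 Zd.
have XZ : X = (fun=> 1%:M) + Z.
  apply/funext => t; apply/eqP; rewrite -subr_eq0 -normr_eq0 eq_le normr_ge0 andbT.
  have [c [c0 Mc XS]] := X_S `|t - t0|.
  apply/ler_addgt0Pl => e e0; rewrite addr0.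
  have [N HN] := half_small (2 * expR (c * `|t - t0|)) e0.
  have HD s : is_derive s (1 : R) (S N.+1 - ((fun=> 1%:M) + Z))
      (M s *m S N s - M s *m X s).
    apply: (is_derive_eq (is_deriveB (S_derive N s)
      (is_deriveD (is_derive_cstT _ s) (Zd s)))).
    by rewrite add0r.
  have D0 : (S N.+1 - ((fun=> 1%:M) + Z)) t0 = 0.
    by rewrite !fctE S_init Z0 addr0 subrr.
  have K0 : 0 <= c / 2 * (2 * 2^-1 ^+ N).
    by rewrite !mulr_ge0 ?exprn_ge0// ltW.
  have := gronwall_mx (L := `|t - t0|) HD D0 c0 K0 => /(_ _ t (lexx _)) Hg.
  have {Hg} H1 : `|S N.+1 t - (1%:M + Z t)| <= 2^-1 ^+ N * expR (c * `|t - t0|).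
    move: Hg; rewrite (_ : _ / c = 2^-1 ^+ N); last by field; rewrite gt_eqF.
    apply => s sL; rewrite -mulmxBr (le_trans (mx_norm_mul _ _))// -[leRHS]mulrA.
    by rewrite ler_pM ?mulr_ge0 ?Mc// distrC XS.
  rewrite -(subrKA (S N.+1 t)) (le_trans (ler_normD _ _))//.
  rewrite (le_trans (lerD (XS _ _ (lexx _)) H1))// (le_trans _ HN)//.
  by rewrite exprS; lra.
exists X; split=> [|t]; first by rewrite XZ !fctE Z0 addr0.
rewrite [X in is_derive _ _ X _]XZ.
apply: (is_derive_eq (is_deriveD (is_derive_cstT _ t) (Zd t))).
by rewrite add0r.
Qed.

End existence.

End linear_ode.

(** * Differentiating determinants and inverses *)

Section inverse.
Context {R : realType}.

Lemma derivable_bigprod {I : Type} (r : seq I) (f : I -> R -> R) (t : R) :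
  (forall i, derivable (f i) t 1) ->
  derivable (fun s => \prod_(i <- r) f i s) t 1.
Proof.
move=> H; elim: r => [|i r IH].
  by under eq_fun do rewrite big_nil; exact: derivable_cst.
by under eq_fun do rewrite big_cons; exact: derivableM.
Qed.

Lemma derivable_bigsum {I : Type} (r : seq I) (f : I -> R -> R) (t : R) :
  (forall i, derivable (f i) t 1) ->
  derivable (fun s => \sum_(i <- r) f i s) t 1.
Proof.
move=> H; elim: r => [|i r IH].
  by under eq_fun do rewrite big_nil; exact: derivable_cst.
by under eq_fun do rewrite big_cons; exact: derivableD.
Qed.

Lemma derivable_det {n} (X : R -> 'M[R]_n) (t : R) :
  derivable X t 1 -> derivable (fun s => \det (X s)) t 1.
Proof.
move=> /derivable_mxP HX; rewrite /determinant.
apply: derivable_bigsum => s; apply: derivableM; first exact: derivable_cst.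
by apply: derivable_bigprod => i; exact: HX.
Qed.

(** Cramer's formula shows that the inverse is derivable; the value then follows by differentiating
    X X^-1 = 1. *)
Lemma is_derive_invmx {n} (X : R -> 'M[R]_n) (t : R) dX :
  (forall s, X s \in unitmx) -> is_derive t (1 : R) X dX ->
  is_derive t (1 : R) (fun s => invmx (X s))
    (- (invmx (X t) *m dX *m invmx (X t))).
Proof.
move=> uX HX.
have dI : derivable (fun s => invmx (X s)) t 1.
  apply/derivable_mxP => i j.
  have -> : (fun s => invmx (X s) i j) =
      (fun s => (\det (X s))^-1 * ((-1) ^+ (j + i) * \det (row' j (col' i (X s))))).
    by apply/funext => s; rewrite /invmx uX !mxE.
  have [HXd _] := HX.
  apply: derivableM.
    apply: derivableV; last exact: derivable_det.
    by have := uX t; rewrite unitmxE unitfE.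
  apply: derivableM; first exact: derivable_cst.
  apply: derivable_det; apply/derivable_mxP => k l.
  under eq_fun do rewrite !mxE.
  by have /derivable_mxP := HXd; exact.
have HI := derivableP dI.
apply: (is_derive_eq HI); set D := derive _ _ _.
have := is_derive_mulmx HX HI; rewrite -/D.
have -> : (fun s => X s *m invmx (X s)) = (fun=> 1%:M).
  by apply/funext => s; rewrite mulmxV.
move=> /@derive_val; rewrite (@derive_val _ _ _ _ _ _ _ (is_derive_cstT _ _)).
move=> /esym/eqP; rewrite addrC addr_eq0 => /eqP/(congr1 (mulmx (invmx (X t)))).
by rewrite mulmxA mulVmx// mul1mx mulmxN mulmxA.
Qed.

End inverse.

(** * The state transition matrix *)

Section transition_matrix.
Context {R : realType} {n : nat} (M : R -> 'M[R]_n).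
Hypothesis cM : continuous M.

Let Phi := transition M.

Lemma transitionP : is_transition M Phi.
Proof.
rewrite /Phi /transition; case: xgetP => [? _ //|H]; exfalso.
pose F t0 := sval (cid (linear_ode_exists t0 cM)).
apply: (H (fun t t0 => F t0 t)) => t0.
exact: (svalP (cid (linear_ode_exists t0 cM))).
Qed.

Lemma transitionxx t : Phi t t = 1%:M.
Proof. by have [] := transitionP t. Qed.

Lemma is_derive_transition s t :
  is_derive t (1 : R) (Phi ^~ s) (M t *m Phi t s).
Proof. by have [_] := transitionP s; exact. Qed.

(** The adjoint solution is the transpose of a solution of X' = - M^T X. Its product with any
    solution of X' = M X is constant, which yields uniqueness for the latter. *)
Let adjoint_transition r : exists Psi : R -> 'M[R]_n,
  Psi r = 1%:M /\ forall t, is_derive t (1 : R) Psi (- (Psi t *m M t)).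
Proof.
have [X [X0 HX]] := linear_ode_exists r (continuous_oppmx (continuous_trmx cM)).
exists (fun t => (X t)^T); split=> [|t]; first by rewrite X0 trmx1.
have := is_derive_trmx (HX t); rewrite mulNmx raddfN /= trmx_mul trmxK.
exact.
Qed.

Let Psi_ode {m} r Psi (X : R -> 'M[R]_(n, m)) t :
  Psi r = 1%:M -> (forall t, is_derive t (1 : R) Psi (- (Psi t *m M t))) ->
  (forall t, is_derive t (1 : R) X (M t *m X t)) -> Psi t *m X t = X r.
Proof.
move=> P1 HP HX; rewrite -[RHS]mul1mx -P1.
apply: (@is_derive_mx_cst _ _ _ (fun t => Psi t *m X t)) => u.
apply: (is_derive_eq (is_derive_mulmx (HP u) (HX u))).
by rewrite mulNmx mulmxA addNr.
Qed.

(** Psi t sends both sides to X s, and it is invertible because its product with Phi t s is 1. *)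
Lemma ode_transition {m} (X : R -> 'M[R]_(n, m)) s t :
  (forall t, is_derive t (1 : R) X (M t *m X t)) -> X t = Phi t s *m X s.
Proof.
move=> HX; have [Psi [P1 HP]] := adjoint_transition s.
have E := Psi_ode t P1 HP (is_derive_transition s); rewrite transitionxx in E.
have Eu : Psi t \in unitmx by have [] := mulmx1_unit E.
by apply: (can_inj (mulKmx Eu)); rewrite mulmxA E mul1mx (Psi_ode t P1 HP HX).
Qed.

Lemma transition_comp t s r : Phi t s *m Phi s r = Phi t r.
Proof. by rewrite -(ode_transition _ _ (is_derive_transition r)). Qed.

Lemma transition_unit t s : Phi t s \in unitmx.
Proof.
by have := transition_comp t s t; rewrite transitionxx => /mulmx1_unit[].
Qed.

Lemma invmx_transition t s : invmx (Phi t s) = Phi s t.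
Proof.
apply: (can_inj (mulKmx (transition_unit t s))).
by rewrite mulmxV ?transition_unit// transition_comp transitionxx.
Qed.

(** As a function of its second argument the transition matrix is the adjoint solution, both being
    inverse to Phi s r. *)
Lemma is_derive_transition2 r t :
  is_derive t (1 : R) (Phi r) (- (Phi r t *m M t)).
Proof.
have [Psi [P1 HP]] := adjoint_transition r.
suff -> : Phi r = Psi by [].
apply/funext => s; have := Psi_ode s P1 HP (is_derive_transition r).
rewrite transitionxx => /(congr1 (mulmx^~ (Phi r s))).
by rewrite -mulmxA transition_comp transitionxx mulmx1 mul1mx.
Qed.

Lemma transition_periodic T t s : periodic M T -> Phi (t + T) (s + T) = Phi t s.
Proof.
move=> pM; rewrite [LHS](@ode_transition _ (fun t => Phi (t + T) (s + T)) s t).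
  by rewrite transitionxx mulmx1.
move=> u; have := is_derive_addr (is_derive_transition (s + T) (u + T)).
by rewrite pM.
Qed.

End transition_matrix.

(** * Quadratic forms *)

Section dot_product.
Context {R : realType} {n : nat}.
Implicit Types u v w : 'cV[R]_n.

Lemma dotE u v : dot u v = (u^T *m v) 0 0.
Proof. by rewrite mxE; apply: eq_bigr => i _; rewrite mxE. Qed.

Lemma dotC u v : dot u v = dot v u.
Proof. by apply: eq_bigr => i _; rewrite mulrC. Qed.

Lemma dotDr u v w : dot u (v + w) = dot u v + dot u w.
Proof. by rewrite !dotE mulmxDr mxE. Qed.

Lemma dotNr u v : dot u (- v) = - dot u v.
Proof. by rewrite !dotE mulmxN mxE. Qed.

Lemma dotZr u (c : R) v : dot u (c *: v) = c * dot u v.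
Proof. by rewrite !dotE -scalemxAr mxE. Qed.

Lemma dotDl u v w : dot (v + w) u = dot v u + dot w u.
Proof. by rewrite dotC dotDr !(dotC u). Qed.

Lemma dotNl u v : dot (- v) u = - dot v u.
Proof. by rewrite dotC dotNr dotC. Qed.

Lemma dotZl u (c : R) v : dot (c *: v) u = c * dot v u.
Proof. by rewrite dotC dotZr dotC. Qed.

Lemma dot_ge0 v : 0 <= dot v v.
Proof. by apply: sumr_ge0 => i _; rewrite -expr2 sqr_ge0. Qed.

Lemma dot_eq0 v : dot v v = 0 -> v = 0.
Proof.
move=> /eqP; rewrite psumr_eq0 => [/allP H|i _]; last by rewrite -expr2 sqr_ge0.
apply/matrixP => i j; rewrite (ord1 j) mxE; apply/eqP.
by have := H i (mem_index_enum _); rewrite /= mulf_eq0 orbb.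
Qed.

End dot_product.

Section quadratic_forms.
Context {R : realType} {n : nat}.
Implicit Types (P A : 'M[R]_n) (v : 'cV[R]_n).

Lemma dot_congruence {m} (P : 'M[R]_n) (B : 'M[R]_(m, n)) (v : 'cV[R]_m) :
  dot v (B *m P *m B^T *m v) = dot (B^T *m v) (P *m (B^T *m v)).
Proof. by rewrite [RHS]dotE trmx_mul trmxK !mulmxA dotE !mulmxA. Qed.

Definition psd P := forall v, 0 <= dot v (P *m v).

Lemma posdef_psd P : posdef P -> psd P.
Proof.
move=> [_ HP] v; have [->|v0] := eqVneq v 0; last exact/ltW/HP.
by rewrite mulmx0 dotE mulmx0 mxE.
Qed.

Lemma posdefD P A : posdef P -> A^T = A -> psd A -> posdef (P + A).
Proof.
move=> [Ps HP] As HA; split=> [|v v0]; first by rewrite raddfD /= Ps As.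
by rewrite mulmxDl dotDr ltr_wpDr// HP.
Qed.

Lemma posdef_unit P : posdef P -> P \in unitmx.
Proof.
move=> [Ps HP]; rewrite -row_free_unit -kermx_eq0; apply/rowV0P => u.
move=> /sub_kermxP uP; apply/eqP/negPn/negP => u0.
have := HP u^T; rewrite trmx_eq0 => /(_ u0).
by rewrite -[P]Ps -trmx_mul uP trmx0 dotE mulmx0 mxE ltxx.
Qed.

(** Writing v = P w turns the form of P^-1 at v into the form of P at w. *)
Lemma posdef_invmx P : posdef P -> posdef (invmx P).
Proof.
move=> HP; have uP := posdef_unit HP; have [Ps Hv] := HP.
have Is : (invmx P)^T = invmx P by rewrite trmx_inv Ps.
split=> // v v0; have -> : v = P *m (invmx P *m v) by rewrite mulKVmx.
set w := invmx P *m v; rewrite dotC mulKmx//; apply: Hv.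
by apply: contra_neq v0 => w0; rewrite -[v](mulKVmx uP) -/w w0 mulmx0.
Qed.

(* A vanishing value of a semidefinite form is a minimum, so its gradient vanishes. *)
Lemma psd_eq0 P v : P^T = P -> psd P -> dot v (P *m v) = 0 -> P *m v = 0.
Proof.
move=> Ps HP v0; set w := P *m v; apply: dot_eq0.
apply/eqP; rewrite eq_le dot_ge0 andbT leNgt; apply/negP => w0.
have wPv (c : R) : 0 <= c * (c * dot w (P *m w) - 2 * dot w w).
  have := HP (c *: w - v); rewrite mulmxBr -scalemxAr -/w.
  rewrite !(dotDl, dotDr, dotNl, dotNr, dotZl, dotZr) v0.
  have -> : dot v (P *m w) = dot w w by rewrite !dotE mulmxA -[P]Ps -trmx_mul.
  by congr (_ <= _); ring.
have := HP w; rewrite le_eqVlt => /orP[/eqP q0|q0].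
  have := wPv 1; rewrite -q0; lra.
(* This c minimises the quadratic in [wPv], whose value there would be - c <w, w> < 0. *)
have := wPv (dot w w / dot w (P *m w)).
rewrite divfK ?gt_eqF// => H.
have : 0 < dot w w / dot w (P *m w) by rewrite divr_gt0.
move=> /pmulr_rge0 E; move: H; rewrite E; lra.
Qed.

End quadratic_forms.

(** * The Lyapunov differential equation *)

Section lyapunov.
Context {R : realType} {n : nat} (M A : R -> 'M[R]_n).
Hypothesis cM : continuous M.
Hypothesis cA : continuous A.

Let Phi := transition M.

Definition lyapunov_solution (P : R -> 'M[R]_n) : Prop :=
  forall t, is_derive t (1 : R) P (M t *m P t + P t *m (M t)^T + A t).

Lemma riccati_lyapunov G : (forall t, G t \in unitmx) ->
  riccati_solution M A G -> lyapunov_solution (fun t => invmx (G t)).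
Proof.
move=> uG HG t; apply: (is_derive_eq (is_derive_invmx uG (HG t))).
have GV : G t *m invmx (G t) = 1%:M by rewrite mulmxV.
rewrite !mulmxBr !mulmxBl mulmxN mulNmx !mulmxA mulVmx// !mul1mx.
rewrite -(mulmxA _ (G t)) -(mulmxA (A t)) GV !mulmx1.
by rewrite !opprB opprK addrC.
Qed.

Lemma lyapunov_riccati P : (forall t, P t \in unitmx) ->
  lyapunov_solution P -> riccati_solution M A (fun t => invmx (P t)).
Proof.
move=> uP HP t; apply: (is_derive_eq (is_derive_invmx uP (HP t))).
rewrite !mulmxDr !mulmxDl !mulmxA mulVmx// mul1mx.
rewrite -(mulmxA _ (P t)) mulmxV// mulmx1.
by rewrite !opprD [X in X + _]addrC.
Qed.

(** Conjugation by Phi r s pulls P s back to time r; the terms in M cancel and only the forcing A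
    remains. Uniqueness, the Gramian identity and the monotonicity of the form below all come from
    this derivative. *)
Lemma is_derive_lyapunov_flow P r s : lyapunov_solution P ->
  is_derive s (1 : R) (fun s => Phi r s *m P s *m (Phi r s)^T)
    (Phi r s *m A s *m (Phi r s)^T).
Proof.
move=> HP; have H2 := is_derive_transition2 cM r s.
apply: (is_derive_eq
  (is_derive_mulmx (is_derive_mulmx H2 (HP s)) (is_derive_trmx H2))).
rewrite !raddfN /= trmx_mul !mulNmx !mulmxDr !mulmxDl !mulmxA mulNmx.
set a := _ *m P s *m _; set b := _ *m (M s)^T *m _; set c := _ *m A s *m _.
by rewrite addrA addrA addNr add0r addrAC subrr add0r.
Qed.

Lemma lyapunov_unique P Q t0 : lyapunov_solution P -> lyapunov_solution Q ->
  P t0 = Q t0 -> P = Q.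
Proof.
move=> HP HQ E; apply/funext => t.
have := @is_derive_mx_cst _ _ _ (fun s => Phi t s *m P s *m (Phi t s)^T -
  Phi t s *m Q s *m (Phi t s)^T) t t0.
rewrite E subrr /Phi (transitionxx cM) !mul1mx trmx1 !mulmx1 => H.
apply/eqP; rewrite -subr_eq0; apply/eqP/H => s.
apply: (is_derive_eq (is_deriveB (is_derive_lyapunov_flow t s HP)
  (is_derive_lyapunov_flow t s HQ))).
by rewrite subrr.
Qed.

Lemma lyapunov_exists P0 t0 : exists P, lyapunov_solution P /\ P t0 = P0.
Proof.
have cPhi : continuous (Phi t0).
  exact: is_derive_continuous (is_derive_transition2 cM t0).
have [H0 HH] := mx_antiderivative
  (continuous_mulmx (continuous_mulmx cPhi cA) (continuous_trmx cPhi)).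
(* Variation of constants: H is the solution pulled back to time t0. *)
pose H s := P0 - H0 t0 + H0 s.
have HH' s : is_derive s (1 : R) H (Phi t0 s *m A s *m (Phi t0 s)^T).
  apply: (is_derive_eq (is_deriveD (is_derive_cstT (P0 - H0 t0) s) (HH s))).
  by rewrite add0r.
exists (fun t => Phi t t0 *m H t *m (Phi t t0)^T); split; last first.
  by rewrite /Phi (transitionxx cM) mul1mx trmx1 mulmx1 /H subrK.
move=> t; have H1 := is_derive_transition cM t0 t.
apply: (is_derive_eq
  (is_derive_mulmx (is_derive_mulmx H1 (HH' t)) (is_derive_trmx H1))).
rewrite trmx_mul !mulmxDl !mulmxA addrAC; congr (_ + _ + _).
rewrite (transition_comp cM) (transitionxx cM) mul1mx -mulmxA -trmx_mul.
by rewrite (transition_comp cM) (transitionxx cM) trmx1 mulmx1.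
Qed.

(** The integrand of the Gramian is the derivative in s of the pullback of P to time t, so the
    fundamental theorem applies to each entry; at s = t the pullback is P t itself. *)
Lemma gramian_lyapunov P t0 t : lyapunov_solution P -> t0 < t ->
  gramian M A t t0 = P t - Phi t t0 *m P t0 *m (Phi t t0)^T.
Proof.
move=> HP t0t.
have cPhi : continuous (Phi t).
  exact: is_derive_continuous (is_derive_transition2 cM t).
have /continuous_mxP cI := continuous_mulmx (continuous_mulmx cPhi cA)
  (continuous_trmx cPhi).
apply/matrixP => i j; rewrite mxE.
pose F s := (Phi t s *m P s *m (Phi t s)^T) i j.
have HF s : is_derive s (1 : R) F ((Phi t s *m A s *m (Phi t s)^T) i j).
  exact: ((is_derive_mxP _ _ _).1 (is_derive_lyapunov_flow t s HP)).
have cF := is_derive_continuous HF.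
rewrite /Rintegral (@continuous_FTC2 _ _ F)//.
- by rewrite -EFinB /= /F /Phi (transitionxx cM) trmx1 mul1mx mulmx1 !mxE.
- apply: continuous_subspaceT; exact: cI.
- split.
  + by move=> s _; have [] := HF s.
  + by apply: cvg_at_right_filter; exact: cF.
  + by apply: cvg_at_left_filter; exact: cF.
- by move=> s _; rewrite derive1E; have [_ ->] := HF s.
Qed.

(** The form of the pullback at v has as derivative in s a value of the form of A s, hence is
    nondecreasing. *)
Lemma lyapunov_psd P t0 t : (forall s, psd (A s)) -> lyapunov_solution P ->
  t0 <= t -> psd (P t - Phi t t0 *m P t0 *m (Phi t t0)^T).
Proof.
move=> HA HP t0t v.
pose X s := v^T *m (Phi t s *m P s *m (Phi t s)^T) *m v.
have HX s := is_derive_mulmxr v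
  (is_derive_mulmxl v^T (is_derive_lyapunov_flow t s HP)).
have := @is_derive_nondecreasing _ (fun s => X s 0 0) _ t0 t
  (fun s => (is_derive_mxP _ _ _).1 (HX s) 0 0) t0t.
move=> H; rewrite mulmxBl dotDr dotNr subr_ge0 !dotE !mulmxA.
have := H _; rewrite /X /Phi (transitionxx cM) trmx1 mul1mx mulmx1 !mulmxA.
apply=> s _; have := HA s ((transition M t s)^T *m v).
by rewrite -dot_congruence dotE !mulmxA.
Qed.

End lyapunov.

(** * Spectral radius and the Stein equation *)

Section spectral_radius.
Context {R : realType}.
Local Notation C := R[i].
Local Notation toC := (map_mx (real_complex R)).

Lemma left_eigenvector_exists {k} (F : 'M[C]_k) : (0 < k)%N ->
  exists (w : 'rV[C]_k) (mu : C), w != 0 /\ w *m F = mu *: w.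
Proof.
move=> k0; have [|mu] := closed_rootP (char_poly F) _.
  by rewrite size_char_poly eqSS -lt0n.
by rewrite -eigenvalue_root_char => /eigenvalueP[w Hw w0]; exists w, mu.
Qed.

(** The modulus in [R[i]] is itself a complex number; its real part moves it to [R], where order and
    limits are used. *)
Definition cnorm (z : C) : R := complex.Re `|z|.

Lemma cnormE z : `|z| = (cnorm z)%:C%C.
Proof. by rewrite RRe_real ?normr_real. Qed.

Lemma cnorm_ge0 z : 0 <= cnorm z.
Proof. by rewrite -ler0c -cnormE. Qed.

Lemma cnormD z z' : cnorm (z + z') <= cnorm z + cnorm z'.
Proof. by rewrite -lecR rmorphD /= -!cnormE ler_normD. Qed.

Lemma cnormM z z' : cnorm (z * z') = cnorm z * cnorm z'.
Proof. by apply: complexI; rewrite rmorphM /= -!cnormE normrM. Qed.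

Lemma cnorm_real (x : R) : cnorm x%:C%C = `|x|.
Proof. by apply: complexI; rewrite -cnormE normc_def /= expr0n addr0 sqrtr_sqr. Qed.

Lemma sqr_cnorm z : cnorm z ^+ 2 = complex.Re z ^+ 2 + complex.Im z ^+ 2.
Proof. by apply: complexI; rewrite rmorphXn /= -cnormE add_Re2_Im2. Qed.

Lemma cvg0_linear_recurrence (a b : nat -> R) (r : R) :
  (forall k, 0 <= a k) -> 0 <= r < 1 ->
  (forall k, a k.+1 <= r * a k + b k) -> b @ \oo --> 0 -> a @ \oo --> 0.
Proof.
move=> a0 /andP[r0 r1] Ha Hb; apply/cvgrPdist_le => e e0.
(* e / 2 is the fixed point of a |-> r a + d, so once b <= d the bound r^m a N + e / 2
   propagates. *)
pose d := e / 2 * (1 - r).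
have r1' : 0 < 1 - r by rewrite subr_gt0.
have d0 : 0 < d by rewrite mulr_gt0// divr_gt0.
have /cvgrPdist_le/(_ d d0)[N _ HN] := Hb.
have HaN m : a (N + m)%N <= r ^+ m * a N + e / 2.
  elim: m => [|m IH]; first by rewrite addn0 expr0 mul1r lerDl divr_ge0// ltW.
  rewrite addnS (le_trans (Ha _))//.
  have bm : b (N + m)%N <= d.
    have := HN (N + m)%N (leq_addr _ _); rewrite /= sub0r normrN.
    exact: le_trans (ler_norm _).
  rewrite (le_trans (lerD (ler_wpM2l r0 IH) bm))// exprS /d; lra.
have Hr : (fun m => r ^+ m * a N) @ \oo --> (0 * a N).
  by apply: cvgMl; apply: cvg_expr; rewrite ger0_norm.
rewrite mul0r in Hr.
have /cvgrPdist_le/(_ (e / 2) (divr_gt0 e0 (ltr0Sn R 1)))[m0 _ Hm] := Hr.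
exists (N + m0)%N => // k /= Nk.
have mk : (m0 <= k - N)%N by rewrite leq_subRL// (leq_trans _ Nk)// leq_addr.
rewrite sub0r normrN ger0_norm// -(subnKC (leq_trans (leq_addr _ _) Nk)).
rewrite (le_trans (HaN _))// [leRHS](splitr e) lerD2r.
have := Hm _ mk; rewrite /= sub0r normrN; exact: le_trans (ler_norm _).
Qed.

Let shifts {n} (F : 'M[C]_n) (s : seq C) (u : 'rV[C]_n) : 'rV[C]_n :=
  foldl (fun u z => u *m (F - z%:M)) u s.

Let shifts_char_poly {n} (F : 'M[C]_n) (s : seq C) (u : 'rV[C]_n) :
  char_poly F = \prod_(z <- s) ('X - z%:P) -> shifts F s u = 0.
Proof.
case: n F u => [|m] F u Hs; first by apply/rowP => -[].
have E v : shifts F s v = v *m horner_mx F (\prod_(z <- s) ('X - z%:P)).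
  elim: s {Hs} v => [|z s IH] v /=; first by rewrite big_nil rmorph1 mulmx1.
  rewrite big_cons rmorphM /= IH rmorphB /= horner_mx_X horner_mx_C.
  by rewrite -mulmxA mulmxE.
by rewrite E -Hs Cayley_Hamilton mulmx0.
Qed.

Context {n : nat}.

Definition schur_stable (F : 'M[R]_n) : Prop :=
  forall z : C, root (char_poly (toC F)) z -> cnorm z < 1.

(** Induction on s: the rows w k = v k (F - z) form an orbit annihilated by the remaining shifts,
    hence tend to 0, and v (k + 1) = z v k + w k with |z| < 1. *)
Let shifts_cvg0 (F : 'M[C]_n) (s : seq C) (v : nat -> 'rV[C]_n) :
  (forall z, z \in s -> cnorm z < 1) ->
  (forall k, v k.+1 = v k *m F) -> shifts F s (v 0%N) = 0 ->
  forall j, (fun k => cnorm (v k 0 j)) @ \oo --> (0 : R).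
Proof.
elim: s v => [|z s IH] v Hs Hv /= H0 j.
  have v0 k : v k = 0 by elim: k => // k IHk; rewrite Hv IHk mul0mx.
  under eq_fun do rewrite v0 mxE (cnorm_real 0) normr0.
  exact: cvg_cst.
pose w k := v k *m (F - z%:M).
have Hw k : w k.+1 = w k *m F.
  by rewrite /w Hv -!mulmxA mulmxBl mulmxBr scalar_mxC.
have w0 : (fun k => cnorm (w k 0 j)) @ \oo --> (0 : R).
  by apply: IH => // x xs; apply: Hs; rewrite inE xs orbT.
apply: (@cvg0_linear_recurrence _ (fun k => cnorm (w k 0 j)) (cnorm z)) => //.
- by move=> k; exact: cnorm_ge0.
- by rewrite cnorm_ge0 Hs// mem_head.
move=> k; rewrite -cnormM (le_trans _ (cnormD _ _))//.
suff -> : v k.+1 0 j = z * v k 0 j + w k 0 j by [].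
have -> : v k.+1 = z *: v k + w k by rewrite Hv /w mulmxBr mul_mx_scalar addrC subrK.
by rewrite [LHS]mxE [X in X + _]mxE.
Qed.

(* Cayley-Hamilton writes 0 as a product of shifts F - z with |z| < 1; each shift
   is removed by one application of cvg0_linear_recurrence. *)
Lemma schur_stable_cvg0 (F : 'M[R]_n) (x : nat -> 'rV[R]_n) :
  schur_stable F -> (forall k, x k.+1 = x k *m F) ->
  forall j, (fun k => x k 0 j) @ \oo --> (0 : R).
Proof.
move=> HF Hx j.
have [s Hs] := closed_field_poly_normal (char_poly (toC F)).
have Hv k : toC (x k.+1) = toC (x k) *m toC F by rewrite Hx map_mxM.
rewrite (monicP (char_poly_monic _)) scale1r in Hs.
have Hz z : z \in s -> cnorm z < 1.
  by move=> zs; apply: HF; rewrite Hs root_prod_XsubC.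
have H0 := shifts_char_poly (toC (x 0%N)) Hs.
have := shifts_cvg0 Hz Hv H0 j => H.
apply/cvgrPdist_le => e e0.
have /cvgrPdist_le/(_ e e0) := H; apply: filterS => k.
rewrite mxE cnorm_real !sub0r !normrN.
by rewrite ger0_norm.
Qed.

End spectral_radius.

(** * The Stein equation P = F P F^T + W *)

Section stein.
Context {R : realType} {n : nat}.
Local Notation toC := (map_mx (real_complex R)).
Implicit Types F P W D : 'M[R]_n.

Let form_cvg0 F P (u v : 'rV[R]_n) : schur_stable F ->
  (fun k => (iter k (mulmxr F) u *m P *m (iter k (mulmxr F) v)^T) 0 0) @ \oo
    --> (0 : R).
Proof.
move=> HF.
have Hc (w : 'rV[R]_n) j : (fun k => iter k (mulmxr F) w 0 j) @ \oo --> (0 : R).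
  have := @schur_stable_cvg0 R n F (fun k => iter k (mulmxr F) w) HF.
  by apply.
have -> : (0 : R) = \sum_(j < n) (\sum_(i < n) 0 * P i j) * 0.
  by rewrite big1// => j _; rewrite mulr0.
under eq_fun do rewrite mxE.
apply: cvg_bigsum => j; apply: cvgM; last by under eq_fun do rewrite mxE; exact: Hc.
under eq_fun do rewrite mxE.
by apply: cvg_bigsum => i; apply: cvgM; [exact: Hc|exact: cvg_cst].
Qed.

Let row_form F P W : P = F *m P *m F^T + W -> forall u v : 'rV[R]_n,
  (u *m P *m v^T) 0 0 =
  (mulmxr F u *m P *m (mulmxr F v)^T) 0 0 + (u *m W *m v^T) 0 0.
Proof.
move=> E u v; rewrite {1}E /= trmx_mul mulmxDr mulmxDl [LHS]mxE.
by rewrite !mulmxA.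
Qed.

(** The bilinear form of D takes the same value at u F^k and v F^k for every k, and these rows tend
    to 0. *)
Lemma stein_unique F D : schur_stable F -> D = F *m D *m F^T -> D = 0.
Proof.
move=> HF E; apply/matrixP => i j; rewrite mxE.
pose u := delta_mx 0 i : 'rV[R]_n; pose v := delta_mx 0 j : 'rV[R]_n.
have Hk k : (iter k (mulmxr F) u *m D *m (iter k (mulmxr F) v)^T) 0 0 = D i j.
  elim: k => [|k IH].
    by rewrite /= -rowE trmx_delta -colE !mxE.
  rewrite !iterS -IH [RHS](@row_form F D 0); last by rewrite addr0.
  by rewrite mulmx0 mul0mx [X in _ + X]mxE addr0.
have := form_cvg0 D u v HF.
under eq_fun do rewrite Hk.
by move=> /cvg_lim <-//; rewrite lim_cst.
Qed.

(** The operator D |-> D - F D F^T, written as a matrix K on vectorised matrices, is injective by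
    [stein_unique], hence invertible in finite dimension. *)
Lemma stein_exists F W : schur_stable F -> exists P, P = F *m P *m F^T + W.
Proof.
move=> HF; pose K : 'M[R]_(n * n) := 1%:M - lin_mulmx F *m lin_mulmxr F^T.
have KE D : mxvec D *m K = mxvec (D - F *m D *m F^T).
  by rewrite mulmxBr mulmx1 mulmxA !mul_vec_lin /= linearB.
have uK : K \in unitmx.
  rewrite -row_free_unit -kermx_eq0; apply/rowV0P => u /sub_kermxP.
  rewrite -[u]vec_mxK KE => /eqP; rewrite mxvec_eq0 subr_eq0 => /eqP.
  by move=> /(stein_unique HF) ->; rewrite linear0.
exists (vec_mx (mxvec W *m invmx K)); set P := vec_mx _.
apply/eqP; rewrite addrC -subr_eq; apply/eqP.
by apply: (can_inj mxvecK); rewrite -KE vec_mxK mulmxKV.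
Qed.

(** Along the orbit v^T F^k the form of P decreases, each time by a value of the form of W, and it
    tends to 0; so it starts nonnegative. *)
Lemma stein_psd F P W : schur_stable F -> P = F *m P *m F^T + W -> psd W -> psd P.
Proof.
move=> HF E HW v; rewrite dotE mulmxA.
pose q k := (iter k (mulmxr F) v^T *m P *m (iter k (mulmxr F) v^T)^T) 0 0.
have Hq k : q k <= q 0%N.
  elim: k => // k; apply: le_trans.
  rewrite {2}/q (row_form E) /q -iterS lerDl.
  by have := HW (iter k (mulmxr F) v^T)^T; rewrite dotE trmxK mulmxA.
have := form_cvg0 P v^T v^T HF; rewrite -/q => Hc.
have -> : (v^T *m P *m v) 0 0 = q 0%N by rewrite /q /= trmxK.
rewrite -(cvg_lim _ Hc)//; apply: limr_le; first by apply/cvg_ex; exists 0.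
by apply: nearW => k; exact: Hq.
Qed.

Lemma stein_eq0 F P (x : 'rV[R]_n) : schur_stable F ->
  (forall k, iter k (mulmxr F) x *m P *m (iter k (mulmxr F) x)^T =
    mulmxr F (iter k (mulmxr F) x) *m P *m (mulmxr F (iter k (mulmxr F) x))^T) ->
  (x *m P *m x^T) 0 0 = 0.
Proof.
move=> HF H.
have Hk k : (iter k (mulmxr F) x *m P *m (iter k (mulmxr F) x)^T) 0 0 =
    (x *m P *m x^T) 0 0.
  by elim: k => // k IH; rewrite iterS -H.
have := form_cvg0 P x x HF.
under eq_fun do rewrite Hk.
by move=> /cvg_lim <-//; rewrite lim_cst.
Qed.

Lemma Re_mulmx_real (u : 'rV[R[i]]_n) F :
  map_mx (@complex.Re R) (u *m toC F) = map_mx (@complex.Re R) u *m F.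
Proof.
apply/rowP => j; rewrite !mxE (raddf_sum (@complex.Re R)); apply: eq_bigr => k _.
by rewrite !mxE; case: (u 0 k) => a b /=; rewrite mulr0 subr0.
Qed.

Lemma Im_mulmx_real (u : 'rV[R[i]]_n) F :
  map_mx (@complex.Im R) (u *m toC F) = map_mx (@complex.Im R) u *m F.
Proof.
apply/rowP => j; rewrite !mxE (raddf_sum (@complex.Im R)); apply: eq_bigr => k _.
by rewrite !mxE; case: (u 0 k) => a b /=; rewrite mulr0 add0r.
Qed.

(** x and y are the real and imaginary parts of a complex left eigenvector. *)
Lemma real_eigenpair F (z : R[i]) : root (char_poly (toC F)) z ->
  exists x y : 'rV[R]_n, [/\ (x != 0) || (y != 0),
    x *m F = complex.Re z *: x - complex.Im z *: y &
    y *m F = complex.Im z *: x + complex.Re z *: y].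
Proof.
rewrite -eigenvalue_root_char => /eigenvalueP[u Hu u0].
exists (map_mx (@complex.Re R) u), (map_mx (@complex.Im R) u); split.
- apply: contraR u0; rewrite negb_or !negbK => /andP[/eqP x0 /eqP y0].
  apply/eqP/rowP => j; have := congr1 (fun A : 'rV_n => A 0 j) x0.
  have := congr1 (fun A : 'rV_n => A 0 j) y0; rewrite !mxE.
  by case: (u 0 j) => a b /= -> ->.
- rewrite -Re_mulmx_real Hu; apply/rowP => j; rewrite !mxE.
  by case: z {Hu} (u 0 j) => a b [c d].
- rewrite -Im_mulmx_real Hu; apply/rowP => j; rewrite !mxE.
  by case: z {Hu} (u 0 j) => a b [c d] /=; rewrite addrC.
Qed.

(** The Stein equation makes the form q of P satisfy q (u F) <= q u, whereas on the two parts of a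
    left eigenvector F multiplies q x + q y by |z|^2. *)
Lemma stein_cnorm_le1 F P W z : posdef P -> psd W -> P = F *m P *m F^T + W ->
  root (char_poly (toC F)) z -> cnorm z <= 1.
Proof.
move=> HP HW E /real_eigenpair[x [y [xy0 xF yF]]].
have [Ps HPv] := HP.
pose q (u : 'rV[R]_n) := dot u^T (P *m u^T).
have q0 u : 0 <= q u by exact: posdef_psd.
have qF u : q (u *m F) <= q u.
  rewrite /q {2}E mulmxDl dotDr dot_congruence trmx_mul lerDl; exact: HW.
have pos : 0 < q x + q y.
  case/orP: xy0 => [x0|y0].
    by rewrite ltr_pwDl// HPv// trmx_eq0.
  by rewrite ltr_pwDr// HPv// trmx_eq0.
have := lerD (qF x) (qF y).
have -> : q (x *m F) + q (y *m F) = cnorm z ^+ 2 * (q x + q y).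
  rewrite xF yF sqr_cnorm /q !(raddfD, raddfN) /= !linearZ /=.
  rewrite !(dotDl, dotDr, dotNl, dotNr, dotZl, dotZr).
  rewrite (_ : dot y^T (P *m x^T) = dot x^T (P *m y^T)); first ring.
  by rewrite dotC !dotE trmx_mul Ps mulmxA.
rewrite -[leRHS]mul1r ler_pM2r// => z2.
by rewrite -(@ler_pXn2r _ 2) ?nnegrE ?cnorm_ge0// expr1n.
Qed.

(** A left eigenvector x + i y of F^T is, transposed, a right eigenvector of F. As |z| = 1, F
    rotates the pair x^T, y^T and so preserves x^T x + y^T y. *)
Lemma unimodular_invariant_form F z : root (char_poly (toC F)) z -> cnorm z = 1 ->
  exists Q : 'M[R]_n, [/\ Q != 0, Q^T = Q, psd Q & F *m Q *m F^T = Q].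
Proof.
move=> Hz z1.
have : root (char_poly (toC F^T)) z.
  rewrite -map_trmx /char_poly -det_tr /char_poly_mx raddfB /= tr_scalar_mx.
  by rewrite -map_trmx trmxK.
move=> /real_eigenpair[x [y [xy0 xF yF]]].
exists (x^T *m x + y^T *m y); split.
- apply: contraTneq xy0 => Q0; rewrite negb_or !negbK.
  have qv (w : 'cV[R]_n) : dot (x *m w) (x *m w) + dot (y *m w) (y *m w) = 0.
    have := congr1 (fun A => (w^T *m A *m w) 0 0) Q0.
    rewrite mulmx0 mul0mx mulmxDr mulmxDl !mxE => H.
    by rewrite -[RHS]H !dotE !trmx_mul !mulmxA [RHS]/= !mxE.
  have z0 (w : 'rV[R]_n) : (forall v : 'cV[R]_n, w *m v = 0) -> w = 0.
    move=> H; apply: trmx_inj; rewrite trmx0; apply: dot_eq0.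
    by rewrite dotE trmxK H mxE.
  apply/andP; split; apply/eqP/z0 => w; apply: dot_eq0; apply/eqP.
    by have /eqP := qv w; rewrite paddr_eq0 ?dot_ge0// => /andP[].
  by have /eqP := qv w; rewrite paddr_eq0 ?dot_ge0// => /andP[].
- by rewrite raddfD /= !trmx_mul !trmxK.
- move=> v; rewrite mulmxDl dotDr addr_ge0//.
    rewrite (_ : dot _ _ = dot (x *m v) (x *m v)) ?dot_ge0//.
    by rewrite !dotE trmx_mul !mulmxA.
  rewrite (_ : dot _ _ = dot (y *m v) (y *m v)) ?dot_ge0//.
  by rewrite !dotE trmx_mul !mulmxA.
- have sum1 : complex.Re z ^+ 2 + complex.Im z ^+ 2 = 1 by rewrite -sqr_cnorm z1 expr1n.
  rewrite mulmxDr mulmxDl !mulmxA -(mulmxA _ x) -(mulmxA _ y).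
  have -> : F *m x^T = (x *m F^T)^T by rewrite trmx_mul trmxK.
  have -> : F *m y^T = (y *m F^T)^T by rewrite trmx_mul trmxK.
  rewrite xF yF; apply/matrixP => i j; rewrite !mxE !big_ord1 !mxE.
  rewrite -[RHS]mul1r -sum1; ring.
Qed.

End stein.

(** * Controllability of a constant pair *)

Section constant_pair.
Context {R : realType} {n : nat}.
Local Notation toC := (map_mx (real_complex R)).
Implicit Types F P W B : 'M[R]_n.

(* The left kernel of [P] is [F]-invariant and annihilates [W]; hence it is
   invariant under exp (t F) and contains an eigenvector of exp (T F). *)
Lemma stein_posdef (T : R) F P W :
  controllable T (fun=> F) (fun=> W) -> P^T = P -> W^T = W -> psd P -> psd W ->
  P = F *m P *m F^T + W -> posdef P.
Proof.
move=> Hctrl Ps Ws HP HW E; split=> // v v0.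
rewrite lt_neqAle HP andbT eq_sym; apply/negP => /eqP q0.
have {q0} Pv := psd_eq0 Ps HP q0.
have [B [Beq Bfr]] : exists B : 'M[R]_(\rank (kermx P), n),
    (B :=: kermx P)%MS /\ row_free B.
  by exists (row_base (kermx P)); split; [exact: eq_row_base|exact: row_base_free].
have BP : B *m P = 0.
  by apply/sub_kermxP; rewrite Beq.
have kP (w : 'cV[R]_n) : P *m w = 0 -> P *m (F^T *m w) = 0 /\ W *m w = 0.
  move=> Pw; have : dot w (P *m w) = 0 by rewrite Pw dotE mulmx0 mxE.
  rewrite {1}E mulmxDl dotDr dot_congruence => /eqP.
  rewrite paddr_eq0; [|exact: HP|exact: HW] => /andP[/eqP p0 /eqP w0].
  by split; [exact: psd_eq0 p0|exact: psd_eq0 w0].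
have rowP0 (X : 'M[R]_(\rank (kermx P), n)) :
    (forall i, P *m (row i X)^T = 0) -> X *m P = 0.
  move=> H; apply/row_matrixP => i; rewrite row_mul row0.
  by apply: trmx_inj; rewrite trmx_mul Ps H trmx0.
have rowB i : P *m (row i B)^T = 0.
  by apply: trmx_inj; rewrite trmx_mul trmxK Ps -row_mul BP row0 trmx0.
have BW : B *m W = 0.
  apply/row_matrixP => i; rewrite row_mul row0.
  by apply: trmx_inj; rewrite trmx_mul Ws (kP _ (rowB i)).2 trmx0.
have BFP : (B *m F <= kermx P)%MS.
  apply/sub_kermxP/rowP0 => i; rewrite row_mul trmx_mul.
  exact: (kP _ (rowB i)).1.
(* C is the action of F on the left kernel, in the coordinates given by the rows of B. *)
pose C := B *m F *m pinvmx B.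
have BF : B *m F = C *m B.
  by rewrite mulmxKpV// Beq.
have cC : continuous (fun _ : R => C) by move=> ?; exact: cvg_cst.
have cF : continuous (fun _ : R => F) by move=> ?; exact: cvg_cst.
have BPhi t s : B *m transition (fun=> F) t s = transition (fun=> C) t s *m B.
  have H u : is_derive u (1 : R) (fun u => B *m transition (fun=> F) u s)
      (C *m (B *m transition (fun=> F) u s)).
    by have /= := is_derive_mulmxl B (is_derive_transition cF s u);
      rewrite !mulmxA BF.
  by rewrite (ode_transition cC s t H) (transitionxx cF) mulmx1.
(* A left eigenvector of the monodromy of C lifts through B to one of the monodromy of F; C has
   positive size because v^T lies in the kernel. *)
have [|w [mu [w0 Hw]]] := @left_eigenvector_exists R _
    (toC (monodromy T (fun=> C) 0)).
  rewrite lt0n mxrank_eq0; apply/eqP => K0.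
  have /sub_kermxP : v^T *m P = 0 by rewrite -[P]Ps -trmx_mul Pv trmx0.
  by rewrite K0 submx0 trmx_eq0 (negPf v0).
have Bfree : B *m pinvmx B = 1%:M by rewrite mulmxVp.
apply: Hctrl; exists (w *m toC B), mu; split.
- apply: contra_neq w0 => u0; rewrite -[w]mulmx1 -(map_mx1 (real_complex R)) -Bfree.
  by rewrite map_mxM mulmxA u0 mul0mx.
- by rewrite -mulmxA -map_mxM /monodromy BPhi map_mxM mulmxA Hw scalemxAl.
- move=> t _; rewrite -mulmxA -map_mxM mulmxA (invmx_transition cF) BPhi.
  by rewrite -mulmxA BW mulmx0 map_mx0 mulmx0.
Qed.

(** Differentiating x Phi(0, t) W = 0 repeatedly gives x Phi(0, t) F^k W = 0. So W annihilates the
    orbit y F^k of y = x Phi(0, T / 2); by the Stein equation the form of P is constant along it,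
    and stability makes that constant 0. *)
Let real_controllable (T : R) F P W (x : 'rV[R]_n) : 0 < T ->
  schur_stable F -> posdef P -> P = F *m P *m F^T + W ->
  (forall t, 0 <= t <= T ->
    x *m (invmx (transition (fun=> F) t 0) *m W) = 0) -> x = 0.
Proof.
move=> T0 HF HP E Hx.
have cF : continuous (fun _ : R => F) by move=> ?; exact: cvg_cst.
pose Phi := transition (fun _ : R => F).
have Hk k t : t \in `]0, T[ -> x *m (Phi 0 t *m iter k (mulmx F) W) = 0.
  elim: k t => [|k IH] t tT.
    rewrite /Phi -(invmx_transition cF) Hx//.
    by move: tT; rewrite in_itv/= => /andP[/ltW -> /ltW ->].
  have H := is_derive_mulmxl x (is_derive_mulmxr (iter k (mulmx F) W)
    (is_derive_transition2 cF 0 t)).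
  (* On the open interval the induction hypothesis holds in a neighbourhood of t, so the derivative
     is 0. *)
  have H0 : is_derive t (1 : R)
      (fun s => x *m (Phi 0 s *m iter k (mulmx F) W)) 0.
    apply: near_eq_is_derive (is_derive_cstT 0 t).
    have : \near t, t \in `]0, T[%R by exact: near_in_itvoo.
    by apply: filterS => s /IH ->.
  move: H => /@derive_val; rewrite (@derive_val _ _ _ _ _ _ _ H0).
  by rewrite mulNmx mulmxN -mulmxA => /esym/eqP; rewrite oppr_eq0 => /eqP.
have T2 : T / 2 \in `]0, T[.
  by rewrite in_itv/= divr_gt0//= ltr_pdivrMr// ltr_pMr// ltr1n.
pose y := x *m Phi 0 (T / 2).
have yW k : iter k (mulmxr F) y *m W = 0.
  have -> : iter k (mulmxr F) y *m W = y *m iter k (mulmx F) W.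
    elim: k W {E Hx Hk} => // k IH W'; rewrite iterS /= -mulmxA IH.
    by rewrite -iterSr.
  by rewrite -mulmxA Hk.
have : (y *m P *m y^T) 0 0 = 0.
  apply: (stein_eq0 HF) => k; set z := iter k _ y.
  rewrite {1}E mulmxDr yW addr0 /= trmx_mul !mulmxA //.
have [Ps HPv] := HP.
have -> : (y *m P *m y^T) 0 0 = dot y^T (P *m y^T) by rewrite dotE trmxK mulmxA.
move=> q0; have /eqP y0 : y == 0.
  by apply/negPn/negP => y0; have := HPv y^T; rewrite q0 ltxx trmx_eq0 => /(_ y0).
by rewrite -[x](mulmxK (transition_unit cF 0 (T / 2))) -/Phi -/y y0 mul0mx.
Qed.

(** Since the matrices are real, the real and imaginary parts of u satisfy the annihilation
    condition separately. *)
Lemma stein_controllable (T : R) F P W : 0 < T ->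
  schur_stable F -> posdef P -> P = F *m P *m F^T + W ->
  controllable T (fun=> F) (fun=> W).
Proof.
move=> T0 HF HP E [u [mu [u0 _ Hu]]].
have Hre : map_mx (@complex.Re R) u = 0.
  apply: (real_controllable T0 HF HP E) => t /Hu H.
  by rewrite -Re_mulmx_real H; apply/rowP => j; rewrite !mxE.
have Him : map_mx (@complex.Im R) u = 0.
  apply: (real_controllable T0 HF HP E) => t /Hu H.
  by rewrite -Im_mulmx_real H; apply/rowP => j; rewrite !mxE.
move/eqP: u0; apply; apply/rowP => j; rewrite mxE.
have := congr1 (fun A : 'rV_n => A 0 j) Hre.
have := congr1 (fun A : 'rV_n => A 0 j) Him; rewrite !mxE.
by case: (u 0 j) => a b /= -> ->.
Qed.

End constant_pair.

(** * The periodic Riccati equation *)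

Section periodic_riccati.
Context {R : realType} {n : nat} (M A : R -> 'M[R]_n) (T : R).
Hypothesis cM : continuous M.
Hypothesis cA : continuous A.
Hypothesis T_gt0 : 0 < T.
Hypothesis pM : periodic M T.
Hypothesis pA : periodic A T.
Hypothesis symA : forall t, (A t)^T = A t.
Hypothesis psdA : forall t, psd (A t).
Local Notation toC := (map_mx (real_complex R)).

Let F := monodromy T M.
Let W t := gramian M A (t + T) t.

Lemma char_poly_similar (S : comNzRingType) k (U B V : 'M[S]_k) :
  U *m V = 1%:M -> char_poly (U *m B *m V) = char_poly B.
Proof.
move=> UV; rewrite /char_poly.
have -> : char_poly_mx (U *m B *m V) =
    map_mx polyC U *m char_poly_mx B *m map_mx polyC V.
  rewrite /char_poly_mx mulmxBr mulmxBl !map_mxM /=; congr (_ - _).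
  by rewrite scalar_mxC -mulmxA -map_mxM UV map_mx1 mulmx1.
by rewrite !det_mulmx mulrAC -det_mulmx -map_mxM UV map_mx1 det1 mul1r.
Qed.

(** Monodromy matrices at different times are conjugate through the transition matrix between those
    times. *)
Lemma char_poly_monodromy s t : char_poly (F s) = char_poly (F t).
Proof.
rewrite -(@char_poly_similar _ _ (transition M t s) (F s) (transition M s t)).
  congr char_poly; rewrite /F /monodromy -(transition_periodic cM t s pM).
  by rewrite !(transition_comp cM).
by rewrite (transition_comp cM) (transitionxx cM).
Qed.

Lemma schur_stable_monodromy s t : schur_stable (F s) -> schur_stable (F t).
Proof.
by move=> H z; rewrite -map_char_poly (char_poly_monodromy t s) map_char_poly; exact: H.
Qed.

Lemma periodic_lyapunov_stein P t : periodic P T -> lyapunov_solution M A P ->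
  P t = F t *m P t *m (F t)^T + W t.
Proof.
move=> pP HP; rewrite /W (gramian_lyapunov cM cA HP) ?ltrDl// pP.
by rewrite addrC subrK.
Qed.

Lemma lyapunov_solution_trmx P : lyapunov_solution M A P ->
  lyapunov_solution M A (fun t => (P t)^T).
Proof.
move=> HP t; apply: (is_derive_eq (is_derive_trmx (HP t))).
by rewrite !raddfD /= !trmx_mul trmxK symA addrAC addrC addrA addrC addrA addrAC.
Qed.

(** W t is the value at t + T of the Lyapunov solution that vanishes at t, so it inherits both
    properties from that solution. *)
Lemma gramian_sym_psd t : (W t)^T = W t /\ psd (W t).
Proof.
have [P [HP P0]] := lyapunov_exists cM cA 0 t.
have WE : W t = P (t + T).
  by rewrite /W (gramian_lyapunov cM cA HP) ?ltrDl// P0 mulmx0 mul0mx subr0.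
split.
  have := @lyapunov_unique _ _ M A cM _ P t (lyapunov_solution_trmx HP) HP.
  by rewrite P0 trmx0 WE => /(_ erefl)/(congr1 (fun Q => Q (t + T))).
rewrite WE; have := lyapunov_psd cM psdA HP (t0 := t) (t := t + T).
by rewrite P0 mulmx0 mul0mx subr0; apply; rewrite lerDl ltW.
Qed.

Lemma lyapunov_solution_shift P : lyapunov_solution M A P ->
  lyapunov_solution M A (fun t => P (t + T)).
Proof.
by move=> HP t; have := is_derive_addr (HP (t + T)); rewrite pM pA.
Qed.

(** The Stein equation says that the solution through P0 returns to P0 after one period, and
    uniqueness makes it periodic. For t >= t0 it is a congruence of P0 plus a semidefinite matrix,
    hence positive definite; periodicity carries this to earlier times. *)
Lemma stein_periodic_lyapunov P0 t0 : posdef P0 ->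
  P0 = F t0 *m P0 *m (F t0)^T + W t0 ->
  exists P, [/\ P t0 = P0, periodic P T, forall t, posdef (P t) &
    lyapunov_solution M A P].
Proof.
move=> HP0 E; have [P [HP Pt0]] := lyapunov_exists cM cA P0 t0.
have pP : periodic P T.
  have PT : P (t0 + T) = P t0.
    rewrite Pt0 [RHS]E /W (gramian_lyapunov cM cA HP) ?ltrDl//.
    by rewrite Pt0 [RHS]addrC subrK.
  move=> t; exact: (congr1 (fun Q => Q t)
    (lyapunov_unique cM (lyapunov_solution_shift HP) HP PT)).
have sP t : (P t)^T = P t.
  have Ps : (P t0)^T = P t0 by rewrite Pt0; case: HP0.
  exact: (congr1 (fun Q => Q t)
    (lyapunov_unique cM (lyapunov_solution_trmx HP) HP Ps)).
exists P; split=> // t.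
wlog t0t : t / t0 <= t => [H|].
  pose k := Num.bound `|(t0 - t) / T|.
  rewrite -(periodicn pP k t); apply: H.
  rewrite -lerBlDl -mulr_natr -ler_pdivrMl// mulrC ltW//.
  exact: le_lt_trans (ler_norm _) (archi_boundP (normr_ge0 _)).
set B := transition M t t0.
have -> : P t = B *m P0 *m B^T + (P t - B *m P0 *m B^T) by rewrite addrC subrK.
have [P0s P0v] := HP0.
have Bs : (B *m P0 *m B^T)^T = B *m P0 *m B^T by rewrite !trmx_mul trmxK P0s mulmxA.
apply: posdefD.
- split=> // v v0; rewrite dot_congruence; apply: P0v.
  have uB : B^T \in unitmx by rewrite unitmx_tr; exact: transition_unit.
  by apply: contra_neq v0 => v0; rewrite -[v](mulKmx uB) v0 mulmx0.
- by rewrite raddfB /= Bs sP.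
- by have := lyapunov_psd cM psdA HP t0t; rewrite Pt0.
Qed.

Lemma periodic_riccati_unique_solution :
  (exists! G : R -> 'M[R]_n,
     [/\ periodic G T, forall t, posdef (G t) & riccati_solution M A G])
  <->
  (schur_stable (F 0) /\
   exists t' : R, 0 <= t' < T /\
     controllable T (fun=> F t') (fun=> W t')).
Proof.
split=> [[G [[pG HG ricG] uG]]|[stab [t' [_ ctrl]]]].
  have uGt t := posdef_unit (HG t).
  pose P t := invmx (G t).
  have HP t : posdef (P t) by exact: posdef_invmx.
  have lP : lyapunov_solution M A P by exact: riccati_lyapunov.
  have pP : periodic P T by move=> t; rewrite /P pG.
  have E := periodic_lyapunov_stein 0 pP lP.
  have [Ws HW] := gramian_sym_psd 0.
  have stab : schur_stable (F 0).
    move=> z Hz; rewrite lt_neqAle (stein_cnorm_le1 (HP 0) HW E Hz) andbT.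
    apply/eqP => z1.
    have [Q [Q0 Qs Qpsd FQ]] := unimodular_invariant_form Hz z1.
    (* P 0 + Q satisfies the same Stein equation, hence starts a second periodic positive definite
       solution, against uniqueness. *)
    have [P2 [P20 pP2 HP2 lP2]] : exists P2, [/\ P2 0 = P 0 + Q, periodic P2 T,
        forall t, posdef (P2 t) & lyapunov_solution M A P2].
      apply: stein_periodic_lyapunov; first exact: posdefD.
      by rewrite mulmxDr mulmxDl FQ {1}E addrAC.
    have := uG (fun t => invmx (P2 t)) => H.
    have {H} GE : G = (fun t => invmx (P2 t)).
      apply: H; split.
      - by move=> t; rewrite pP2.
      - by move=> t; exact: posdef_invmx.
      - by apply: lyapunov_riccati => // t; exact: posdef_unit.
    have : P 0 = P2 0 by rewrite /P GE invmxK.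
    rewrite P20 => /eqP; rewrite -subr_eq0 opprD addrA subrr add0r oppr_eq0.
    by rewrite (negPf Q0).
  split=> //; exists 0; split; first by rewrite lexx.
  exact: stein_controllable (HP 0) E.
have stabt t : schur_stable (F t) by exact: schur_stable_monodromy stab.
have [Ws HW] := gramian_sym_psd t'.
have [P0 E] := stein_exists (W t') (stabt t').
(* P0^T solves the same Stein equation because W t' is symmetric. *)
have P0s : P0^T = P0.
  apply/eqP; rewrite -subr_eq0; apply/eqP/(stein_unique (stabt t')).
  rewrite mulmxBr mulmxBl -[RHS](addrKA (W t')) [W t' + _]addrC -E; congr (_ - _).
  by rewrite [in LHS]E raddfD /= !trmx_mul trmxK Ws mulmxA.
have HP0 : posdef P0.
  exact: (stein_posdef ctrl P0s Ws (stein_psd (stabt t') E HW) HW E).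
have [P [Pt' pP HP lP]] := stein_periodic_lyapunov HP0 E.
exists (fun t => invmx (P t)); split.
  split=> [t|t|]; first by rewrite pP.
    exact: posdef_invmx.
  by apply: lyapunov_riccati => // t; exact: posdef_unit.
move=> G [pG HG ricG]; apply/funext => t.
have lP1 : lyapunov_solution M A (fun t => invmx (G t)).
  by apply: riccati_lyapunov => // s; exact: posdef_unit.
have pP1 : periodic (fun t => invmx (G t)) T by move=> s; rewrite pG.
rewrite -[RHS]invmxK; congr invmx; apply/eqP; rewrite -subr_eq0.
(* At every t both inverses solve the Stein equation with the same W t, so their difference solves
   the homogeneous one. *)
apply/eqP/(stein_unique (stabt t)).
rewrite {1}(periodic_lyapunov_stein t pP lP) {1}(periodic_lyapunov_stein t pP1 lP1).
by rewrite [X in _ - X]addrC addrKA mulmxBr mulmxBl.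
Qed.

End periodic_riccati.

(** * Moving frames *)

Section frame.
Context {R : realType} {n : nat}.
Context (b : 'cV[R]_n.+1 -> 'cV[R]_n.+1) (sigma : 'cV[R]_n.+1 -> 'M[R]_n.+1).
Context (gamma : R -> 'cV[R]_n.+1) (T : R).
Context (e edual : 'I_n.+1 -> R -> 'cV[R]_n.+1) (lam : R -> R).
Hypothesis b_smooth : smooth b.
Hypothesis cycle : limit_cycle b gamma T.
Hypothesis frame : moving_frame gamma T e edual lam.
Hypothesis M_cont : continuous (M_t b gamma e edual).
Local Notation toC := (map_mx (real_complex R)).

Let M := M_t b gamma e edual.
Let J t := jacobian_mx b (gamma t).

Lemma derive1_periodic (V : normedModType R) (f : R -> V) :
  (forall t : R, derivable f t (1 : R)) -> periodic f T -> periodic (derive1 f) T.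
Proof.
move=> df pf t; rewrite !derive1E; have := is_derive_addr (derivableP (df (t + T))).
have -> : (fun s => f (s + T)) = f by apply/funext.
by move=> /@derive_val ->.
Qed.

Let e_derivable i (t : R) : derivable (e i) t (1 : R).
Proof. by case: frame. Qed.

Let e_periodic i t : e i (t + T) = e i t.
Proof. exact: (mf_periodic frame i t). Qed.

(** * Frame and reciprocal basis as mutually inverse matrices *)

Let E t : 'M[R]_n.+1 := \matrix_(i, j) e j t i 0.
Let D t : 'M[R]_n.+1 := \matrix_(i, j) edual i t j 0.
Let dE t : 'M[R]_n.+1 := \matrix_(i, j) derive1 (e j) t i 0.
(** Coefficient matrix of the variational equation in frame coordinates: x' = J x becomes y' = K y
    for y = D x. *)
Let K t : 'M[R]_n.+1 := D t *m (J t *m E t - dE t).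

Let DE t : D t *m E t = 1%:M.
Proof.
apply/matrixP => i j; rewrite [RHS]mxE -(mf_reciprocal frame t) mxE.
by apply: eq_bigr => k _; rewrite !mxE.
Qed.

Let ED t : E t *m D t = 1%:M.
Proof. exact: mulmx1C (DE t). Qed.

Let uE t : E t \in unitmx.
Proof. by case: (mulmx1_unit (ED t)). Qed.

Let DEinv t : D t = invmx (E t).
Proof. by apply: (can_inj (mulKmx (uE t))); rewrite ED mulmxV. Qed.

Let E_derive t : is_derive t (1 : R) E (dE t).
Proof.
apply/is_derive_mxP => i j; rewrite mxE derive1E.
have /is_derive_mxP/(_ i 0) := derivableP (@e_derivable j t).
by under [X in _ -> is_derive _ _ X _]eq_fun do rewrite mxE.
Qed.

(** The reciprocal basis inherits differentiability from the frame through D = E^-1. *)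
Let D_derive t : is_derive t (1 : R) D (- (D t *m dE t *m D t)).
Proof.
have -> : D = (fun t => invmx (E t)) by apply/funext => s; rewrite DEinv.
exact: (is_derive_invmx uE (E_derive t)).
Qed.

Let E_periodic t : E (t + T) = E t.
Proof. by apply/matrixP => i j; rewrite !mxE e_periodic. Qed.

Let D_periodic t : D (t + T) = D t.
Proof. by rewrite !DEinv E_periodic. Qed.

Let edual_periodic i t : edual i (t + T) = edual i t.
Proof.
apply/colP => j.
by have := congr1 (fun X : 'M[R]_(n.+1) => X i j) (D_periodic t); rewrite !mxE.
Qed.

Lemma M_periodic : periodic M T.
Proof.
have de i t : derive1 (e i) (t + T) = derive1 (e i) t.
  exact: derive1_periodic (@e_derivable i) (@e_periodic i) t.
move=> t; rewrite /M /M_t; congr (_ - _); apply/matrixP => i j;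
  rewrite [LHS]mxE [RHS]mxE edual_periodic.
  by rewrite e_periodic (lc_periodic cycle).
by rewrite de.
Qed.

Lemma A_periodic : periodic (A_t sigma gamma edual) T.
Proof.
move=> t; apply/matrixP => i j; rewrite [LHS]mxE [RHS]mxE.
by rewrite (edual_periodic (lift ord0 i) t) (edual_periodic (lift ord0 j) t)
  (lc_periodic cycle).
Qed.

(** * Symmetry and semidefiniteness of A *)

Let mulmx_entry m p q (X : 'M[R]_(m, p)) (Y : 'M[R]_(p, q)) i j :
  (X *m Y) i j = (row i X *m col j Y) 0 0.
Proof. by rewrite !mxE; apply: eq_bigr => k _; rewrite !mxE. Qed.

Let col_mulmx m p q (X : 'M[R]_(m, p)) (Y : 'M[R]_(p, q)) j :
  col j (X *m Y) = X *m col j Y.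
Proof. by rewrite !colE mulmxA. Qed.

Let N t : 'M[R]_(n, n.+1) := \matrix_(i, j) edual (lift ord0 i) t j 0.

Let AE t : A_t sigma gamma edual t =
  N t *m diffusion sigma (gamma t) *m (N t)^T.
Proof.
apply/matrixP => i j; rewrite [LHS]mxE mulmx_entry row_mul dotE mulmxA.
congr ((_ *m _ *m _) 0 0); first by apply/rowP => k; rewrite !mxE.
by apply/colP => k; rewrite !mxE.
Qed.

Lemma A_sym t : (A_t sigma gamma edual t)^T = A_t sigma gamma edual t.
Proof. by rewrite AE /diffusion !trmx_mul !trmxK !mulmxA. Qed.

Lemma A_psd t : psd (A_t sigma gamma edual t).
Proof.
move=> v; set S := N t *m sigma (gamma t).
have -> : A_t sigma gamma edual t = S *m 1%:M *m S^T.
  by rewrite AE /diffusion mulmx1 trmx_mul !mulmxA.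
by rewrite dot_congruence mul1mx dot_ge0.
Qed.

(** * The variational equation in the moving frame *)

Let jacobianE x v : 'D_v b x = jacobian_mx b x *m v.
Proof.
have [db _] := b_smooth 1.
have dv w : 'D_w b x = 'd b x w by rewrite deriveE.
rewrite dv {1}(matrix_sum_delta v) linear_sum /=; apply/colP => i.
rewrite summxE mxE; apply: eq_bigr => j _.
by rewrite big_ord1 linearZ /= -dv !mxE mulrC.
Qed.

Let J_cont : continuous J.
Proof.
have [db cdb] := b_smooth 1.
apply/continuous_mxP => i j.
under eq_fun do rewrite mxE.
have cg := is_derive_continuous (lc_sol cycle).
move=> t.
apply: (@continuous_comp _ _ _ (fun t => 'D_(delta_mx j 0) b (gamma t))
  (fun A : 'cV[R]_n.+1 => A i 0)); last exact: coord_continuous.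
apply: (@continuous_comp _ _ _ gamma (fun x => 'D_(delta_mx j 0) b x)).
  exact: cg.
exact: (cdb (delta_mx j 0)).
Qed.

(** By the chain rule the velocity of the cycle solves the variational equation; this is the source
    of the multiplier 1. *)
Let velocity t : is_derive t (1 : R) (fun t => b (gamma t)) (J t *m b (gamma t)).
Proof.
have [db _] := b_smooth 1.
have [dg gE] := lc_sol cycle t.
have dg' : differentiable gamma t by apply/derivable1_diffP.
have dbg : differentiable (b \o gamma) t by exact: differentiable_comp.
apply: DeriveDef; first exact/derivable1_diffP.
have H1 : 'D_(1 : R) (b \o gamma) t = 'd (b \o gamma) t 1 by exact: deriveE.
have H2 : 'D_(1 : R) gamma t = 'd gamma t 1 by exact: deriveE.
have H3 : 'D_(b (gamma t)) b (gamma t) = 'd b (gamma t) (b (gamma t)).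
  by exact: deriveE.
apply: (etrans H1); rewrite (diff_comp dg' (db (gamma t))) -jacobianE.
apply: esym; apply: (etrans H3) => /=; congr ('d b (gamma t) _).
by rewrite -gE; exact: H2.
Qed.

Let frame_ode m (X : R -> 'M[R]_(n.+1, m)) t :
  (forall t, is_derive t (1 : R) X (J t *m X t)) ->
  is_derive t (1 : R) (fun t => D t *m X t) (K t *m (D t *m X t)).
Proof.
move=> HX; apply: (is_derive_eq (is_derive_mulmx (D_derive t) (HX t))).
rewrite /K mulmxBr mulmxBl addrC mulNmx -!mulmxA; congr (_ - _).
by rewrite (mulmxA (E t)) ED mul1mx.
Qed.

Let velocity_frame t : D t *m b (gamma t) = (lam t)^-1 *: delta_mx 0 0.
Proof.
have -> : b (gamma t) = (lam t)^-1 *: e 0 t.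
  rewrite (mf_tangent frame) scalerA mulVf ?(mf_lam_neq0 frame)// scale1r.
  by rewrite derive1E; have [_ ->] := lc_sol cycle t.
rewrite -scalemxAr; congr (_ *: _).
have -> : e 0 t = col 0 (E t) by apply/colP => i; rewrite !mxE.
by rewrite -col_mulmx DE colE mul1mx.
Qed.

(** The components of D b(gamma) beyond the first vanish identically, so their derivatives, which
    are the entries of this column of K divided by lam, vanish too. *)
Let K_col0 t i : K t (lift ord0 i) 0 = 0.
Proof.
have /is_derive_mxP/(_ (lift ord0 i) 0) := frame_ode t velocity.
rewrite velocity_frame -scalemxAr -colE.
have -> : (fun s => (D s *m b (gamma s)) (lift ord0 i) 0) = (fun=> 0).
  by apply/funext => s; rewrite velocity_frame !mxE /= mulr0.
move=> /@derive_val; rewrite (@derive_val _ _ _ _ _ _ _ (is_derive_cstT _ _)).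
rewrite !mxE => /esym/eqP; rewrite mulf_eq0 invr_eq0 (negPf (mf_lam_neq0 frame t)).
by move=> /eqP.
Qed.

Let K_lift t i j : K t (lift ord0 i) (lift ord0 j) = M t i j.
Proof.
have -> : M t i j = dot (edual (lift ord0 i) t)
    (J t *m e (lift ord0 j) t - derive1 (e (lift ord0 j)) t).
  by rewrite dotDr dotNr /M /M_t [LHS]mxE [X in X + _]mxE [X in _ + X]mxE
    [X in - X]mxE.
rewrite /K mulmx_entry linearB /= col_mulmx dotE.
have -> : row (lift ord0 i) (D t) = (edual (lift ord0 i) t)^T.
  by apply/rowP => k; rewrite !mxE.
have -> : col (lift ord0 j) (E t) = e (lift ord0 j) t.
  by apply/colP => k; rewrite !mxE.
have -> : col (lift ord0 j) (dE t) = derive1 (e (lift ord0 j)) t.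
  by apply/colP => k; rewrite !mxE.
by [].
Qed.

(** By [K_col0] the tangential component does not feed into the transverse ones, which therefore
    evolve under M alone. *)
Let frame_transition t : 
  row' ord0 (D t *m (transition J t 0 *m E 0)) =
  transition M t 0 *m row' ord0 (1%:M : 'M[R]_n.+1).
Proof.
have HX s : is_derive s (1 : R) (fun s => transition J s 0 *m E 0)
    (J s *m (transition J s 0 *m E 0)).
  by have := is_derive_mulmxr (E 0) (is_derive_transition J_cont 0 s); rewrite -mulmxA.
have HY s : is_derive s (1 : R)
    (fun s => row' ord0 (D s *m (transition J s 0 *m E 0)))
    (M s *m row' ord0 (D s *m (transition J s 0 *m E 0))).
  have /is_derive_mxP H := frame_ode s HX.
  apply/is_derive_mxP => i j; under eq_fun do rewrite mxE.
  apply: (is_derive_eq (H (lift ord0 i) j)).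
  rewrite [LHS]mxE [RHS]mxE big_ord_recl K_col0 mul0r add0r.
  by apply: eq_bigr => k _; rewrite K_lift; congr (_ * _); rewrite [RHS]mxE.
rewrite (ode_transition M_cont 0 t HY).
by rewrite (transitionxx J_cont) mul1mx DE.
Qed.

Lemma char_poly_ublock (S : comNzRingType) p q (X : 'M[S]_p) (Y : 'M[S]_(p, q))
    (Z : 'M[S]_q) :
  char_poly (block_mx X Y 0 Z) = char_poly X * char_poly Z.
Proof.
rewrite /char_poly /char_poly_mx map_block_mx scalar_mx_block opp_block_mx.
by rewrite add_block_mx map_mx0 oppr0 !addr0 det_ublock.
Qed.

Lemma char_poly_frame :
  char_poly (monodromy T J 0) = ('X - 1) * char_poly (monodromy T M 0).
Proof.
(* Y is the monodromy matrix in frame coordinates, at type ['M_(1 + n)] so that it can be cut into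
   blocks. *)
have [Y defY] : exists Y : 'M[R]_(1 + n), Y = D 0 *m monodromy T J 0 *m E 0.
  by eexists.
rewrite -(char_poly_similar (monodromy T J 0) (DE 0)) -defY.
have YT : Y = D T *m (transition J T 0 *m E 0).
  have DT : D T = D 0 by rewrite -(D_periodic 0) add0r.
  by rewrite defY /monodromy add0r mulmxA DT.
(* The variational flow carries the velocity at time 0 to that at time T; in frame coordinates both
   are 1 / lam times the first unit vector, and lam T = lam 0. *)
have Y0 : Y *m delta_mx 0 0 = delta_mx 0 0 :> 'cV_(1 + n).
  rewrite YT -mulmxA -(mulmxA _ (E 0)) -colE.
  have -> : col 0 (E 0) = lam 0 *: b (gamma 0).
    have -> : col 0 (E 0) = e 0 0 by apply/colP => i; rewrite !mxE.
    rewrite (mf_tangent frame) derive1E.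
    by have [_ ->] := lc_sol cycle 0.
  rewrite -!scalemxAr -(ode_transition J_cont 0 T velocity) velocity_frame.
  have lamT : lam T = lam 0 by rewrite -(mf_lam_periodic frame 0) add0r.
  rewrite lamT scalerA divff ?scale1r//.
  exact: (mf_lam_neq0 frame).
have Yrow : row' ord0 (Y : 'M[R]_(n.+1)) = monodromy T M 0 *m row' ord0 1%:M.
  by rewrite YT frame_transition /monodromy add0r.
have Ycol (i : 'I_(1 + n)) : Y i 0 = (i == 0)%:R.
  have := congr1 (fun X : 'cV[R]_(1 + n) => X i 0) Y0; rewrite -colE !mxE andbT.
  by [].
have YB : Y = block_mx 1%:M (ursubmx Y) 0 (monodromy T M 0).
  rewrite -[LHS]submxK; congr block_mx.
  - apply/matrixP => i j; rewrite !ord1 !mxE lshift0.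
    by rewrite Ycol.
  - by apply/matrixP => i j; rewrite !ord1 !mxE lshift0 Ycol rshift1.
  - apply/matrixP => i j.
    have := congr1 (fun X : 'M[R]_(n, n.+1) => X i (lift ord0 j)) Yrow.
    rewrite mxE [RHS]mxE (bigD1 j)//= big1 => [|k kj].
      by rewrite !mxE eqxx mulr1 addr0 => <-; rewrite !rshift1.
    by rewrite !mxE (inj_eq lift_inj) (negPf kj) mulr0.
have := char_poly_ublock 1%:M (ursubmx Y) (monodromy T M 0).
rewrite -YB => ->; congr (_ * _).
by rewrite /char_poly det_mx11 !mxE.
Qed.

Lemma asymptotically_stableP :
  asymptotically_stable b gamma T <-> schur_stable (monodromy T M 0).
Proof.
have CP : char_poly (toC (monodromy T J 0)) =
    ('X - 1%:P) * char_poly (toC (monodromy T M 0)).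
  by rewrite -!map_char_poly char_poly_frame rmorphM rmorphB /= map_polyX rmorph1.
rewrite /asymptotically_stable /multipliers -/J; split=> [[z [Hz z1]] x|stab].
  (* The head 1 of the list accounts for the factor X - 1; cancelling it leaves the multipliers of
     M. *)
  have : char_poly (toC (monodromy T M 0)) = \prod_(x <- z) ('X - x%:P).
    by move: Hz; rewrite CP big_cons => /mulfI; apply; rewrite polyXsubC_eq0.
  move=> ->; rewrite root_prod_XsubC => /z1; by rewrite cnormE ltcR.
have [s Hs] := closed_field_poly_normal (char_poly (toC (monodromy T M 0))).
rewrite (monicP (char_poly_monic _)) scale1r in Hs.
exists s; split=> [|x xs]; first by rewrite CP big_cons Hs.
by rewrite cnormE ltcR; apply: stab; rewrite Hs root_prod_XsubC.
Qed.

End frame.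

Theorem theorem7 (R : realType) (n : nat)
    (b : 'cV[R]_n.+1 -> 'cV[R]_n.+1) (sigma : 'cV[R]_n.+1 -> 'M[R]_n.+1)
    (gamma : R -> 'cV[R]_n.+1) (T : R)
    (e edual : 'I_n.+1 -> R -> 'cV[R]_n.+1) (lam : R -> R)
    (b_smooth : smooth b)
    (cycle : limit_cycle b gamma T)
    (frame : moving_frame gamma T e edual lam)
    (M_cont : continuous (M_t b gamma e edual))
    (A_cont : continuous (A_t sigma gamma edual)) :
  let M := M_t b gamma e edual in
  let A := A_t sigma gamma edual in
  (exists! G : R -> 'M[R]_n,
     [/\ periodic G T, forall t, posdef (G t) & riccati_solution M A G])
  <->
  (asymptotically_stable b gamma T /\
   exists t' : R, 0 <= t' < T /\
     controllable T (fun=> monodromy T M t') (fun=> gramian M A (t' + T) t')).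
Proof.
move=> M A; rewrite (asymptotically_stableP b_smooth cycle frame M_cont).
have pM : periodic M T := M_periodic cycle frame.
have pA : periodic A T := A_periodic sigma cycle frame.
have sA t : (A t)^T = A t := A_sym sigma gamma edual t.
have hA t : psd (A t) := A_psd sigma gamma edual t.
exact (periodic_riccati_unique_solution M_cont A_cont (lc_period_gt0 cycle)
  pM pA sA hA).
Qed.
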